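(* Assume $\mathrm{Sol}(\widehat{KV})$ is nonempty. Then the group $\widehat{KV}_2$ acts on $\mathrm{Sol}(\widehat{KV})$ by right multiplication $F\mapsto Fg$, and this action is free and transitive.
   Context: $k$ is a field of characteristic zero; $\mathfrak{lie}_n$, $\mathrm{Ass}_n$ are the degree completions of the free Lie and free associative algebras over $k$ on $x_1,\dots,x_n$ ($x,y$ for $n=2$); $a=a_0+\sum_k(\partial_ka)x_k$ is the unique decomposition in $\mathrm{Ass}_n$. $\mathfrak{tr}_n=\mathrm{Ass}_n^+/\langle ab-ba\rangle$ with projection $\mathrm{Tr}$; for $f\in xk[[x]]$, $\mathrm{Tr}(f(x))=\sum f_m\mathrm{Tr}(x^m)$. $\mathrm{ch}(x,y)=\ln(e^xe^y)$. $\mathfrak{tder}_2$: derivations $u$ of $\mathfrak{lie}_2$ with $u(x)=[x,a]$, $u(y)=[y,b]$, written $u=(a,b)$ (normalized: $a$ has no term $\lambda x$, $b$ no term $\lambda y$); $\mathfrak{sder}_2$: those with $u(x+y)=0$. $\mathrm{div}(u)=\mathrm{Tr}(x\partial_xa+y\partial_yb)$; derivations and automorphisms act on $\mathfrak{tr}_2$ via their action on $\mathrm{Ass}_2$. $\delta:\mathfrak{tr}_1\to\mathfrak{tr}_2$, $\delta g=g(x)-g(x+y)+g(y)$ and $\delta:\mathfrak{tr}_2\to\mathfrak{tr}_3$, $(\delta g)(x,y,z)=g(y,z)-g(x+y,z)+g(x,y+z)-g(x,y)$; $\tilde\delta:\mathfrak{tr}_1\to\mathfrak{tr}_2$, $\tilde\delta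 g=g(x)-g(\mathrm{ch}(x,y))+g(y)$. $\widehat{\mathfrak{kv}}_2=\{u\in\mathfrak{sder}_2:\delta(\mathrm{div}\,u)=0\}$. For $u$ a derivation of positive degree, $\exp(u)=\sum_m u^m/m!$ is an automorphism of $\mathfrak{lie}_2$; $\mathrm{TAut}_2=\exp(\mathfrak{tder}_2)$ and $\widehat{KV}_2=\exp(\widehat{\mathfrak{kv}}_2)$ are groups under composition. $j:\mathrm{TAut}_2\to\mathfrak{tr}_2$ is $j(\exp u)=\sum_{m\ge0}\frac{u^m}{(m+1)!}\cdot\mathrm{div}(u)$ (the unique map with $j(gh)=j(g)+g\cdot j(h)$ and $\frac{d}{ds}j(\exp(su))|_{s=0}=\mathrm{div}(u)$). $\mathrm{Sol}(\widehat{KV})$ is the set of $F\in\mathrm{TAut}_2$ with $F(x+y)=\mathrm{ch}(x,y)$ and $j(F)\in\tilde\delta(\mathfrak{tr}_1)$. *)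

(* Defs.v *)
(* Formal (degree-completed) noncommutative power series over
   a field R of characteristic zero, in n variables 'I_n, are represented as
   coefficient functions  seq 'I_n -> R  (a word = a noncommutative monomial). *)
From HB Require Import structures.
From mathcomp Require Import all_boot all_order all_algebra.
Set Implicit Arguments. Unset Strict Implicit. Unset Printing Implicit Defensive.
Import Order.TTheory GRing.Theory Num.Theory.
Local Open Scope ring_scope.

Definition ser (R : fieldType) (n : nat) := seq 'I_n -> R.

Definition szero {R : fieldType} {n : nat} : ser R n := fun _ => 0.
Definition sone {R : fieldType} {n : nat} : ser R n :=
  fun w => if w is [::] then 1 else 0.
Definition sgen {R : fieldType} {n : nat} (i : 'I_n) : ser R n :=
  fun w => if w == [:: i] then 1 else 0.
Definition smono {R : fieldType} {n : nat} (u : seq 'I_n) : ser R n :=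
  fun w => if w == u then 1 else 0.
Definition sadd {R : fieldType} {n : nat} (a b : ser R n) : ser R n :=
  fun w => a w + b w.
Definition sopp {R : fieldType} {n : nat} (a : ser R n) : ser R n :=
  fun w => - a w.
Definition ssub {R : fieldType} {n : nat} (a b : ser R n) : ser R n :=
  sadd a (sopp b).
Definition sscale {R : fieldType} {n : nat} (c : R) (a : ser R n) : ser R n :=
  fun w => c * a w.
Definition smul {R : fieldType} {n : nat} (a b : ser R n) : ser R n :=
  fun w => \sum_(i < (size w).+1) a (take i w) * b (drop i w).
Definition spow {R : fieldType} {n : nat} (a : ser R n) (m : nat) : ser R n :=
  iter m (smul a) sone.
Definition sbr {R : fieldType} {n : nat} (a b : ser R n) : ser R n :=
  ssub (smul a b) (smul b a).
Definition ssum {R : fieldType} {n : nat} (s : seq (ser R n)) : ser R n :=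
  foldr sadd szero s.
Definition shom {R : fieldType} {n : nat} (d : nat) (a : ser R n) : ser R n :=
  fun w => if size w == d then a w else 0.
(* partial derivative: a = a_0 + sum_k (d_k a) x_k *)
Definition sdiff {R : fieldType} {n : nat} (k : 'I_n) (a : ser R n) : ser R n :=
  fun w => a (rcons w k).

(* continuous linear extension of a map on words (phi w must have degree
   >= size w for the sum to be the correct (finite) coefficient) *)
Definition sext {R : fieldType} {n m : nat} (phi : seq 'I_n -> ser R m)
  (f : ser R n) : ser R m :=
  fun v => \sum_(d < (size v).+1) \sum_(w : d.-tuple 'I_n) f w * phi w v.

(* power series c_0 + c_1 z + c_2 z^2 + ... evaluated at z with zero constant term *)
Definition ps_eval {R : fieldType} {n : nat} (c : nat -> R) (z : ser R n) : ser R n :=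
  fun v => \sum_(m < (size v).+1) c m * spow z m v.

Fixpoint lbr {R : fieldType} {n : nat} (w : seq 'I_n) : ser R n :=
  match w with
  | [::] => szero
  | [:: i] => sgen i
  | i :: w' => sbr (sgen i) (lbr w')
  end.
Definition is_lie {R : fieldType} {n : nat} (a : ser R n) : Prop :=
  forall d, exists c : d.-tuple 'I_n -> R,
    shom d a =1 (fun v => \sum_(t : d.-tuple 'I_n) c t * lbr t v).

(* ---- tr_n = Ass_n^+ / (closed span of commutators) ---- *)
(* trz a : the class of a in tr_n is zero, i.e. each homogeneous component of a
   is a finite sum of commutators *)
Definition trz {R : fieldType} {n : nat} (a : ser R n) : Prop :=
  forall d, exists s : seq (ser R n * ser R n),
    shom d a =1 shom d (ssum [seq sbr p.1 p.2 | p <- s]).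
Definition tr_eq {R : fieldType} {n : nat} (a b : ser R n) : Prop := trz (ssub a b).

(* derivation of Ass_n with prescribed values D i on generators, on a word *)
Fixpoint der_word {R : fieldType} {n : nat} (D : 'I_n -> ser R n)
  (w : seq 'I_n) : ser R n :=
  match w with
  | [::] => szero
  | i :: w' => sadd (smul (D i) (smono w')) (smul (sgen i) (der_word D w'))
  end.
Definition der_act {R : fieldType} {n : nat} (D : 'I_n -> ser R n)
  (f : ser R n) : ser R n := sext (der_word D) f.
Definition sexp {R : fieldType} {n : nat} (D : 'I_n -> ser R n)
  (f : ser R n) : ser R n :=
  fun v => \sum_(m < (size v).+1) (m`!%:R)^-1 * iter m (der_act D) f v.

Definition ix : 'I_2 := @Ordinal 2 0 isT.
Definition iy : 'I_2 := @Ordinal 2 1 isT.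
Definition sx {R : fieldType} : ser R 2 := sgen ix.
Definition sy {R : fieldType} : ser R 2 := sgen iy.

Definition tder_gen {R : fieldType} (a b : ser R 2) : 'I_2 -> ser R 2 :=
  fun i => if i == ix then sbr sx a else sbr sy b.
(* normalized elements of tder_2 *)
Definition is_tder {R : fieldType} (a b : ser R 2) : Prop :=
  [/\ is_lie a, is_lie b, a [:: ix] = 0 & b [:: iy] = 0].
Definition is_sder {R : fieldType} (a b : ser R 2) : Prop :=
  is_tder a b /\ sadd (sbr sx a) (sbr sy b) =1 szero.
(* representative of div(u) = Tr(x d_x a + y d_y b) *)
Definition divser {R : fieldType} (a b : ser R 2) : ser R 2 :=
  sadd (smul sx (sdiff ix a)) (smul sy (sdiff iy b)).

(* substitution homomorphism Ass_n -> Ass_m, x_i |-> S i (S i with no constant term) *)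
Fixpoint word_subst {R : fieldType} {n m : nat} (S : 'I_n -> ser R m)
  (w : seq 'I_n) : ser R m :=
  match w with
  | [::] => sone
  | i :: w' => smul (S i) (word_subst S w')
  end.
Definition ssubst {R : fieldType} {n m : nat} (S : 'I_n -> ser R m)
  (f : ser R n) : ser R m := sext (word_subst S) f.

Definition i3x : 'I_3 := @Ordinal 3 0 isT.
Definition i3y : 'I_3 := @Ordinal 3 1 isT.
Definition i3z : 'I_3 := @Ordinal 3 2 isT.
Definition subst2 {R : fieldType} (p q : ser R 3) : 'I_2 -> ser R 3 :=
  fun i => if i == ix then p else q.
(* delta : tr_2 -> tr_3 on representatives *)
Definition delta2 {R : fieldType} (g : ser R 2) : ser R 3 :=
  let X := sgen i3x in let Y := sgen i3y in let Z := sgen i3z in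
  ssub (sadd (ssub (ssubst (subst2 Y Z) g) (ssubst (subst2 (sadd X Y) Z) g))
             (ssubst (subst2 X (sadd Y Z)) g))
       (ssubst (subst2 X Y) g).

Definition is_kv {R : fieldType} (a b : ser R 2) : Prop :=
  is_sder a b /\ trz (delta2 (divser a b)).

Definition expc {R : fieldType} : nat -> R := fun m => (m`!%:R)^-1.
Definition logc {R : fieldType} : nat -> R :=
  fun m => if m is 0 then 0 else (-1) ^+ m.+1 / m%:R.
Definition ch {R : fieldType} : ser R 2 :=
  ps_eval logc (ssub (smul (ps_eval expc sx) (ps_eval expc sy)) sone).

(* representative of j(exp u) = sum_m u^m/(m+1)! . div(u) *)
Definition jser {R : fieldType} (a b : ser R 2) : ser R 2 :=
  fun v => \sum_(m < (size v).+1)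
     ((m.+1)`!%:R)^-1 * iter m (der_act (tder_gen a b)) (divser a b) v.

(* delta-tilde g = g(x) - g(ch(x,y)) + g(y), for g = Tr(f), f = sum_{m>=1} c_m x^m *)
Definition tdelta {R : fieldType} (c : nat -> R) : ser R 2 :=
  sadd (ssub (ps_eval c sx) (ps_eval c ch)) (ps_eval c sy).

Definition is_TAut {R : fieldType} (F : ser R 2 -> ser R 2) : Prop :=
  exists a b, is_tder a b /\ forall f, F f =1 sexp (tder_gen a b) f.

Definition is_Sol {R : fieldType} (F : ser R 2 -> ser R 2) : Prop :=
  exists a b, [/\ is_tder a b,
    (forall f, F f =1 sexp (tder_gen a b) f),
    F (sadd sx sy) =1 ch &
    exists c : nat -> R, c 0%N = 0 /\ tr_eq (jser a b) (tdelta c)].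

Definition is_KVg {R : fieldType} (g : ser R 2 -> ser R 2) : Prop :=
  exists a b, is_kv a b /\ forall f, g f =1 sexp (tder_gen a b) f.

(* Main.v *)
(* Write u.f for the action of a tangential derivation u on series, and exp(u) for the
   automorphism it generates.
   - TAut_2 is closed under composition by Baker-Campbell-Hausdorff. For e^u e^v this is
     proved with the Euler derivation E (multiplication by the degree): a series w gives
     E(e^w) = e^w l(w), where l(w) is E(w) plus brackets of lower-degree parts of w, so
     l(w) = l can be solved degree by degree inside Lie series; and a series g with
     constant term 1 is determined by g^-1 E(g). The identity is then transported to
     operators.
   - The cocycle property of j follows from that of div, by applying
     Baker-Campbell-Hausdorff to the affine operators (f, r) |-> (u.f + r d, 0) with d
     representing div(u): their exponentials are (f, r) |-> (exp(u).f + r j, r).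
   - delta h = 0 forces h = delta1 c in tr_2. In terms of the sums of coefficients over
     rotations of a word, the cocycle equation at a word with exactly one letter x shows
     that these sums are constant, in each degree, on words containing both letters and
     zero on powers of a single letter.
   - For v special with div(v) = delta1 c, v kills Tr c(x), Tr c(y) and c(x + y), hence
     j(exp v) = delta1 c; conversely j(exp v) = delta1 c gives div(v) = delta1 c because
     (e^v - 1)/v is invertible. Finally F maps delta1 c to tdelta c when F(x + y) = ch. *)
Require Import Defs.
From HB Require Import structures.
From mathcomp Require Import all_boot all_order all_algebra.
From mathcomp Require Import boolp.
From mathcomp Require Import ring zify.
Set Implicit Arguments. Unset Strict Implicit. Unset Printing Implicit Defensive.
Import GRing.Theory.
Local Open Scope ring_scope.

(** * The algebra of noncommutative series *)

(** Series are bare coefficient functions without a topology, so causality in word length replaces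
    convergence: an operator to be exponentiated is linear and raises the degree, each coefficient
    of an operator series is then a finite sum, and limits are taken diagonally. Lie series are
    given as spans of nested brackets, with no primitivity criterion at hand; hence
    Baker-Campbell-Hausdorff comes from a differential equation solved by an iteration that stays
    among Lie series. It is applied to two free letters and pushed to operators by the morphism
    [rho]; series in one letter give inverses in the same way. The divergence is a cocycle only
    modulo commutators, so a derivation travels with a representative of its divergence fixed only
    in tr ([good]), and identities in tr become equations between values of [tau]. *)

Section Ring.
Variables (R : fieldType) (n : nat).
Implicit Types (f g h : ser R n) (k : 'I_n) (w v : seq 'I_n).

(** Left counterpart of [sdiff]. Products, substitutions and derivations all satisfy a recursion in
    [dl], so identities between them are proved by induction on the word, read from its first
    letter. *)
Definition dl k f : ser R n := fun w => f (k :: w).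

Lemma smul_nil f g : smul f g [::] = f [::] * g [::].
Proof. by rewrite /smul big_ord1. Qed.

Lemma smul_cons f g k w :
  smul f g (k :: w) = f [::] * g (k :: w) + smul (dl k f) g w.
Proof. by rewrite /smul /= big_ord_recl. Qed.

Lemma smul_rcons f g k w :
  smul f g (rcons w k) = smul f (sdiff k g) w + f (rcons w k) * g [::].
Proof.
rewrite /smul size_rcons big_ord_recr /= take_oversize ?size_rcons //.
rewrite drop_oversize ?size_rcons //; congr (_ + _).
apply: eq_bigr => -[i /= hi] _; rewrite ltnS in hi.
by rewrite /sdiff -cats1 takel_cat // drop_cat; case: ltngtP hi => // [_ _|-> _];
  rewrite ?cats1 // subnn drop_size.
Qed.

Lemma saddA : associative (@sadd R n).
Proof. by move=> f g h; apply: funext => w; rewrite /sadd addrA. Qed.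
Lemma saddC : commutative (@sadd R n).
Proof. by move=> f g; apply: funext => w; rewrite /sadd addrC. Qed.
Lemma sadd0 : left_id (@szero R n) (@sadd R n).
Proof. by move=> f; apply: funext => w; rewrite /sadd add0r. Qed.
Lemma saddN : left_inverse (@szero R n) (@sopp R n) (@sadd R n).
Proof. by move=> f; apply: funext => w; rewrite /sadd /sopp addNr. Qed.
Lemma smulDl : left_distributive (@smul R n) (@sadd R n).
Proof.
move=> f g h; apply: funext => w; rewrite /sadd /smul -big_split /=.
by apply: eq_bigr => i _; rewrite mulrDl.
Qed.
Lemma smulDr : right_distributive (@smul R n) (@sadd R n).
Proof.
move=> f g h; apply: funext => w; rewrite /sadd /smul -big_split /=.
by apply: eq_bigr => i _; rewrite mulrDr.
Qed.
Lemma sscale_mull c f g : sscale c (smul f g) = smul (sscale c f) g.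
Proof.
apply: funext => w; rewrite /sscale /smul mulr_sumr.
by apply: eq_bigr => i _; rewrite mulrA.
Qed.
Lemma sscale_mulr c f g : sscale c (smul f g) = smul f (sscale c g).
Proof.
apply: funext => w; rewrite /sscale /smul mulr_sumr.
by apply: eq_bigr => i _; rewrite mulrCA.
Qed.
Lemma smulA : associative (@smul R n).
Proof.
move=> f g h; apply: funext => w; elim: w f => [|k w IH] f.
  by rewrite !smul_nil mulrA.
(* Removing the first letter is a derivation twisted by the constant term; this reduces the word
   [k :: w] to [w] with [dl k f] in place of [f]. *)
have dlM : dl k (smul f g) = sadd (sscale (f [::]) (dl k g)) (smul (dl k f) g).
  by apply: funext => u; rewrite {1}/dl smul_cons.
rewrite !smul_cons IH dlM smul_nil smulDl -sscale_mull /sadd /sscale.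
by rewrite mulrDr addrA mulrA.
Qed.
Lemma smul1l : left_id (@sone R n) (@smul R n).
Proof.
move=> f; apply: funext => w; rewrite /smul big_ord_recl take0 drop0 mul1r big1 ?addr0 //.
by case: w => [|k w] [i hi] _ //=; rewrite mul0r.
Qed.
Lemma smul1r : right_id (@sone R n) (@smul R n).
Proof.
move=> f; apply: funext => w; elim/last_ind: w => [|w k _].
  by rewrite smul_nil mulr1.
rewrite smul_rcons mulr1 /smul big1 ?add0r // => i _.
by rewrite /sdiff; case: (drop i w) => [|? ?]; rewrite mulr0.
Qed.
Lemma sone_neq0 : (@sone R n) <> szero.
Proof. by move/(congr1 (fun f => f [::]))/eqP; rewrite oner_eq0. Qed.

HB.instance Definition _ := gen_eqMixin (ser R n).
HB.instance Definition _ := gen_choiceMixin (ser R n).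
HB.instance Definition _ :=
  GRing.isZmodule.Build (ser R n) saddA saddC sadd0 saddN.
Lemma sone_neq0b : (@sone R n) != 0 :> ser R n.
Proof. exact/eqP/sone_neq0. Qed.
HB.instance Definition _ := GRing.Zmodule_isNzRing.Build (ser R n)
  smulA smul1l smul1r smulDl smulDr sone_neq0b.
Lemma sscaleA (c d : R) f : sscale c (sscale d f) = sscale (c * d) f.
Proof. by apply: funext => w; rewrite /sscale mulrA. Qed.
Lemma sscale1 : left_id 1 (@sscale R n).
Proof. by move=> f; apply: funext => w; rewrite /sscale mul1r. Qed.
Lemma sscaleDr : right_distributive (@sscale R n) +%R.
Proof. by move=> c f g; apply: funext => w; rewrite /sscale mulrDr. Qed.
Lemma sscaleDl f : {morph (@sscale R n)^~ f : c d / c + d}.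
Proof. by move=> c d; apply: funext => w; rewrite /sscale mulrDl. Qed.
HB.instance Definition _ := GRing.Zmodule_isLmodule.Build R (ser R n)
  sscaleA sscale1 sscaleDr sscaleDl.
HB.instance Definition _ := GRing.Lmodule_isLalgebra.Build R (ser R n)
  sscale_mull.
HB.instance Definition _ := GRing.Lalgebra_isAlgebra.Build R (ser R n)
  sscale_mulr.

Lemma saddE f g : sadd f g = f + g. Proof. by []. Qed.
Lemma smulE f g : smul f g = f * g. Proof. by []. Qed.
Lemma ssubE f g : ssub f g = f - g. Proof. by []. Qed.
Lemma sbrE f g : sbr f g = f * g - g * f. Proof. by []. Qed.
Lemma addfE f g w : (f + g) w = f w + g w. Proof. by []. Qed.
Lemma oppfE f w : (- f) w = - f w. Proof. by []. Qed.
Lemma scalefE c f w : (c *: f) w = c * f w. Proof. by []. Qed.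
Lemma zerofE w : (0 : ser R n) w = 0. Proof. by []. Qed.
Lemma sumfE (I : Type) (s : seq I) (P : pred I) (F : I -> ser R n) w :
  (\sum_(i <- s | P i) F i) w = \sum_(i <- s | P i) F i w.
Proof. by elim/big_rec2: _ => // i x y _ <-. Qed.

End Ring.

(** * Operators raising the degree *)

Section Filtration.
Variables (R : fieldType) (T : Type) (sz : T -> nat).
Implicit Types (phi psi : T -> R) (P : (T -> R) -> T -> R).

(** The index type stays abstract because the same calculus serves series, indexed by words, and the
    affine pairs (f, r), indexed by [option] of words. *)
Definition lin P := forall c phi psi,
  P (fun v => c * phi v + psi v) = (fun v => c * P phi v + P psi v).
Definition eqlo N phi psi := forall v, (sz v < N)%N -> phi v = psi v.
(** Strict causality: the value at [v] depends only on values at smaller sizes. For linear [P] the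
    iterates therefore vanish at [v] after [sz v] steps. *)
Definition raising P := forall N phi psi,
  eqlo N phi psi -> eqlo N.+1 (P phi) (P psi).
(* For P strictly causal the omitted terms vanish at v, so this is the operator
   series sum_k c k P^k. *)
Definition opser (c : nat -> R) P phi : T -> R :=
  fun v => \sum_(k < (sz v).+1) c k * iter k P phi v.

Lemma lin0 P : lin P -> P (fun=> 0) = (fun=> 0).
Proof.
move=> Pl; have := Pl (-1) (fun=> 0) (fun=> 0).
rewrite (_ : (fun v => _) = (fun=> 0)); last by apply: funext => v; rewrite mulr0 addr0.
by move=> ->; apply: funext => v; rewrite mulN1r addNr.
Qed.

Lemma linZ P c phi : lin P -> P (fun v => c * phi v) = (fun v => c * P phi v).
Proof.
move=> Pl; have := Pl c phi (fun=> 0); rewrite lin0 //.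
rewrite (_ : (fun v => c * phi v + 0) = (fun v => c * phi v)); last first.
  by apply: funext => v; rewrite addr0.
by move=> ->; apply: funext => v; rewrite addr0.
Qed.

Lemma lin_iter P k : lin P -> lin (iter k P).
Proof. by move=> Pl; elim: k => // k IH c phi psi; rewrite !iterS (IH c phi psi) Pl. Qed.

Lemma eqlo_le N M phi psi : (N <= M)%N -> eqlo M phi psi -> eqlo N phi psi.
Proof. by move=> NM h v hv; apply: h; apply: leq_trans hv NM. Qed.

Lemma eqlo_all phi psi : (forall N, eqlo N phi psi) -> phi = psi.
Proof. by move=> h; apply: funext => v; apply: (h (sz v).+1). Qed.

Lemma raising_iter P k N phi psi : raising P -> eqlo N phi psi ->
  eqlo (N + k) (iter k P phi) (iter k P psi).
Proof.
move=> Pr h; elim: k => [|k IH]; first by rewrite addn0.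
by rewrite addnS /=; apply: Pr.
Qed.

Lemma iter_small P k phi v : lin P -> raising P -> (sz v < k)%N ->
  iter k P phi v = 0.
Proof.
move=> Pl Pr hv.
(* Any function agrees with 0 below level 0, and each application of [P] lifts the agreement by one
   level. *)
have : eqlo 0 phi (fun=> 0) by [].
move/(@raising_iter P k 0 _ _ Pr) => /(_ v hv) ->.
by rewrite (lin0 (lin_iter k Pl)).
Qed.

Lemma opser_trunc c P phi N v : lin P -> raising P -> (sz v <= N)%N ->
  opser c P phi v = \sum_(k < N.+1) c k * iter k P phi v.
Proof.
move=> Pl Pr hv; rewrite /opser (big_ord_widen N.+1 (fun k => c k * iter k P phi v)) //.
rewrite big_mkcond; apply: eq_bigr => k _; case: ltnP => // hk.
by rewrite (iter_small _ Pl Pr) ?mulr0.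
Qed.

Lemma opser_lin c P : lin P -> lin (opser c P).
Proof.
move=> Pl d phi psi; apply: funext => v; rewrite /opser mulr_sumr -big_split /=.
by apply: eq_bigr => k _; rewrite (lin_iter k Pl d phi psi) mulrDr mulrCA.
Qed.

Lemma opser_eqlo c P N phi psi : raising P -> eqlo N phi psi ->
  eqlo N (opser c P phi) (opser c P psi).
Proof.
move=> Pr h v hv; apply: eq_bigr => k _; congr (_ * _).
by apply: (@raising_iter P k N _ _ Pr h); apply: leq_trans hv (leq_addr _ _).
Qed.

(** The factorization c(P) = c_0 + c'(P) P with c' the shifted sequence; for [expc], c'(z) is (e^z -
    1)/z. *)
Lemma opser_shift c P phi v : lin P -> raising P ->
  opser c P phi v = c 0%N * phi v + opser (fun k => c k.+1) P (P phi) v.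
Proof.
move=> Pl Pr; rewrite (@opser_trunc c P phi (sz v).+1) // big_ord_recl; congr (_ + _).
by apply: eq_bigr => k _; rewrite -iterSr.
Qed.

(* A strictly causal perturbation of a nonzero scalar is injective modulo any
   invariant subspace that is determined by truncations. *)
Definition trunc N phi : T -> R := fun v => if (sz v < N)%N then phi v else 0.

Lemma opser_inj (K : (T -> R) -> Prop) c P phi :
  lin P -> raising P -> c 0%N != 0 ->
  (forall d phi psi, K phi -> K psi -> K (fun v => d * phi v + psi v)) ->
  K (fun=> 0) ->
  (forall phi N, K phi -> K (trunc N phi)) ->
  (forall phi, (forall N, K (trunc N phi)) -> K phi) ->
  (forall phi, K phi -> K (opser (fun k => c k.+1) P (P phi))) ->
  K (opser c P phi) -> K phi.
Proof.
move=> Pl Pr c0 Klin K0 Ktr Kloc KP Kop; apply: Kloc; elim=> [|N IH].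
  by have := K0; congr K; apply: funext => v; rewrite /trunc.
(* Up to level N, A - B equals c_0 phi: there the terms with a factor [P] see [phi] only below level
   N, where its truncation suffices. *)
set A := opser c P phi; set B := opser (fun k => c k.+1) P (P (trunc N phi)).
have KA := Ktr _ N.+1 (Klin (-1) _ _ (KP _ IH) Kop).
have := Klin (c 0%N)^-1 _ _ KA K0; congr K; apply: funext => v.
rewrite /trunc addr0; case: ltnP; rewrite ?mulr0 // => hv.
rewrite (opser_shift c) // mulN1r addrC.
have -> : opser (fun k => c k.+1) P (P phi) v = B v.
  apply: (opser_eqlo _ Pr) (hv); apply: Pr => u hu.
  by rewrite /trunc hu.
by rewrite addrK mulKf.
Qed.

End Filtration.
Arguments lin {R T}.

Notation slo := (@eqlo _ (seq _) size).
Notation sraising := (@raising _ (seq _) size).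

(** * Multiplication and power series against the length filtration *)

Section Series.
Variables (R : fieldType) (n : nat).
Implicit Types (f g h : ser R n) (k : 'I_n) (w v : seq 'I_n).

Lemma sgen_mul_nil k f : (sgen k * f) [::] = 0.
Proof. by rewrite -smulE smul_nil /sgen /= mul0r. Qed.

Lemma sgen_mul_cons k j f w : (sgen k * f) (j :: w) = if j == k then f w else 0.
Proof.
rewrite -smulE smul_cons {1}/sgen /= mul0r add0r smulE.
have -> : dl j (sgen k) = if j == k then 1 else 0 :> ser R n.
  apply: funext => u; rewrite /dl /sgen eqseq_cons; case: eqP => //= _.
  by case: u.
by case: eqP => _; rewrite ?mul1r ?mul0r.
Qed.

Lemma sdiff_sgen k j : sdiff k (sgen j) = (k == j)%:R *: 1 :> ser R n.
Proof.
apply: funext => u; rewrite /sdiff scalefE /sgen.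
case: u => [|i u]; first by rewrite /= eqseq_cons andbT; case: eqP; rewrite ?mul1r ?mul0r.
by rewrite /= eqseq_cons -size_eq0 size_rcons andbF [X in _ * X](_ : _ = 0) // mulr0.
Qed.

Lemma sdecomp f : f = f [::] *: 1 + \sum_k sgen k * dl k f.
Proof.
apply: funext => -[|j w]; rewrite addfE sumfE scalefE.
  rewrite big1 => [|k _]; last exact: sgen_mul_nil.
  by rewrite addr0 [X in _ * X](_ : _ = 1) // mulr1.
rewrite [X in _ * X](_ : _ = 0) // mulr0 add0r (bigD1 j) //= big1.
  by rewrite sgen_mul_cons eqxx addr0.
by move=> k kj; rewrite sgen_mul_cons eq_sym (negbTE kj).
Qed.

Lemma dl_mul k f g : dl k (f * g) = f [::] *: dl k g + dl k f * g.
Proof. by apply: funext => w; rewrite /dl -smulE smul_cons. Qed.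

Lemma mul_nil f g : (f * g) [::] = f [::] * g [::].
Proof. exact: smul_nil. Qed.

Lemma mul_cons f g k w :
  (f * g) (k :: w) = f [::] * g (k :: w) + (dl k f * g) w.
Proof. exact: smul_cons. Qed.

Lemma slo_mul N f f' g g' : slo N f f' -> slo N g g' -> slo N (f * g) (f' * g').
Proof.
move=> hf hg v hv; apply: eq_bigr => i _.
by congr (_ * _); [apply: hf|apply: hg]; apply: leq_ltn_trans hv;
  rewrite ?size_take_min ?size_drop ?leq_subr // geq_minr.
Qed.

Lemma raising_mull f : f [::] = 0 -> sraising (fun g : ser R n => f * g).
Proof.
move=> f0 N g g' h [|k v] hv; first by rewrite !mul_nil f0 !mul0r.
rewrite !mul_cons f0 !mul0r !add0r.
by have /(_ v hv) := @slo_mul N (dl k f) (dl k f) g g' (fun _ _ => erefl) h.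
Qed.

Lemma raising_mulr f : f [::] = 0 -> sraising (fun g : ser R n => g * f).
Proof.
move=> f0 N g g' h v; case/lastP: v => [|v k]; first by rewrite !mul_nil f0 !mulr0.
rewrite size_rcons ltnS => hv; rewrite -!smulE !smul_rcons f0 !mulr0 !addr0.
exact: (@slo_mul N g g' (sdiff k f) (sdiff k f) h (fun _ _ => erefl) v hv).
Qed.

Lemma lin_serP (P : ser R n -> ser R n) :
  (forall c f g, P (c *: f + g) = c *: P f + P g) -> lin P.
Proof. by move=> h c f g; apply: h. Qed.

Lemma lin_mull f : lin (fun g : ser R n => f * g).
Proof. by apply: lin_serP => c g h; rewrite mulrDr scalerAr. Qed.

(** This is [g, f], the opposite of the usual sign: with it e^(-w) l e^w is the exponential series
    of [ad w] at l, and exponentials can always be collected on the left. *)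
Definition ad f g : ser R n := g * f - f * g.

Lemma lin_ad f : lin (ad f).
Proof.
apply: lin_serP => c g h; rewrite /ad mulrDl mulrDr -scalerAl -scalerAr.
by rewrite scalerBr opprD addrACA.
Qed.

Lemma raising_ad f : f [::] = 0 -> sraising (ad f).
Proof.
move=> f0 N g g' h v hv; rewrite /ad !addfE !oppfE.
by rewrite (raising_mull f0 h hv) (raising_mulr f0 h hv).
Qed.

Lemma spowE f m : spow f m = f ^+ m.
Proof. by elim: m => [|m IH] //; rewrite exprS -IH. Qed.

Lemma ps_evalE c f : ps_eval c f = opser size c (smul f) sone.
Proof. by []. Qed.

Lemma ps_eval_trunc c f N v : f [::] = 0 -> (size v <= N)%N ->
  ps_eval c f v = (\sum_(k < N.+1) c k *: f ^+ k) v.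
Proof.
move=> f0 hv; rewrite ps_evalE (opser_trunc c _ (lin_mull f) (raising_mull f0) hv).
by rewrite sumfE; apply: eq_bigr => k _; rewrite -spowE.
Qed.

Lemma sum_tuple_cons d (F : seq 'I_n -> R) :
  \sum_(w : d.+1.-tuple 'I_n) F w = \sum_k \sum_(w : d.-tuple 'I_n) F (k :: w).
Proof.
rewrite pair_big /= (reindex (fun p : 'I_n * d.-tuple 'I_n => [tuple of p.1 :: p.2])) //=.
exists (fun w : d.+1.-tuple 'I_n => (thead w, [tuple of behead w])) => [[k w] _|w _] /=.
  by congr pair; apply: val_inj.
by rewrite [RHS]tuple_eta; apply: val_inj.
Qed.

Lemma sum_tuple0 (F : seq 'I_n -> R) : \sum_(w : 0.-tuple 'I_n) F w = F [::].
Proof.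
by rewrite (big_pred1 [tuple]) // => w; apply/esym/eqP; exact: tuple0.
Qed.

End Series.

(** * Continuous extension of maps on words *)

Section Sext.
Variables (R : fieldType) (n m : nat).
Implicit Types (f g : ser R n) (phi : seq 'I_n -> ser R m).

(** The bound does not depend on the word of evaluation, so this is a finite sum in the algebra,
    open to ring rewriting. *)
Definition sextN N phi f : ser R m :=
  \sum_(d < N) \sum_(w : d.-tuple 'I_n) f w *: phi w.

Lemma sextN_E N phi f v :
  sextN N phi f v = \sum_(d < N) \sum_(w : d.-tuple 'I_n) f w * phi w v.
Proof. by rewrite /sextN sumfE; apply: eq_bigr => d _; rewrite sumfE. Qed.

Definition raising_words phi := forall w v, (size v < size w)%N -> phi w v = 0.

Lemma sext_trunc phi f N v : raising_words phi -> (size v < N)%N ->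
  sext phi f v = sextN N phi f v.
Proof.
move=> hphi hv; rewrite sextN_E /sext.
rewrite (big_ord_widen N (fun d => \sum_(w : d.-tuple 'I_n) f w * phi w v)) //.
rewrite big_mkcond; apply: eq_bigr => d _; case: ltnP => // hd.
by rewrite big1 // => w _; rewrite hphi ?mulr0 // size_tuple.
Qed.

Lemma sextN_S N phi f : sextN N.+1 phi f =
  f [::] *: phi [::] + \sum_k sextN N (fun w => phi (k :: w)) (dl k f).
Proof.
apply: funext => v; rewrite addfE sumfE sextN_E big_ord_recl /=.
rewrite (sum_tuple0 (fun w => f w * phi w v)); congr (_ + _).
under eq_bigr => d _ do rewrite (sum_tuple_cons _ (fun w => f w * phi w v)).
by rewrite exchange_big; apply: eq_bigr => k _; rewrite sextN_E.
Qed.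

Lemma sextN_mull N a phi f : sextN N (fun w => a * phi w) f = a * sextN N phi f.
Proof.
rewrite mulr_sumr; apply: eq_bigr => d _; rewrite mulr_sumr.
by apply: eq_bigr => w _; rewrite scalerAr.
Qed.

Lemma sextN_add N phi psi f :
  sextN N (fun w => phi w + psi w) f = sextN N phi f + sextN N psi f.
Proof.
rewrite -big_split; apply: eq_bigr => d _; rewrite -big_split.
by apply: eq_bigr => w _; rewrite scalerDr.
Qed.

Lemma sext_lin phi c f g : sext phi (c *: f + g) = c *: sext phi f + sext phi g.
Proof.
apply: funext => v; rewrite addfE scalefE /sext mulr_sumr -big_split.
apply: eq_bigr => d _; rewrite mulr_sumr -big_split; apply: eq_bigr => w _ /=.
by rewrite addfE scalefE mulrDl mulrA.
Qed.

End Sext.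

(** * Substitution homomorphisms *)

Section Subst.
Variables (R : fieldType) (n m : nat) (S : 'I_n -> ser R m).
Hypothesis S0 : forall i, S i [::] = 0.

Lemma raising_word_subst : raising_words (word_subst S).
Proof.
elim=> [|k w IH] // v hv /=.
have : slo (size w) (word_subst S w) (0 : ser R m) by move=> u; apply: IH.
by move/(raising_mull (S0 k))/(_ v hv); rewrite mulr0.
Qed.

Lemma ssubst_rec (f : ser R n) :
  ssubst S f = f [::] *: 1 + \sum_k S k * ssubst S (dl k f).
Proof.
apply: funext => v.
rewrite [LHS](sext_trunc (N := (size v).+1) f raising_word_subst) //.
rewrite sextN_S !addfE !sumfE; congr (_ + _); apply: eq_bigr => k _ /=.
rewrite sextN_mull; apply: (raising_mull (S0 k) _ (ltnSn (size v))) => u hu.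
by apply/esym/sext_trunc => //; exact: raising_word_subst.
Qed.

(* Substituting for each letter a sum of letters, disjoint for distinct letters,
   is pulling back along the induced partial map q of alphabets with domain p. *)
Lemma ssubst_letters (p : pred 'I_m) (q : 'I_m -> 'I_n) (f : ser R n) v :
  (forall i, S i = (fun w => if w is [:: j] then (p j && (q j == i))%:R else 0)) ->
  ssubst S f v = if all p v then f (map q v) else 0.
Proof.
move=> HS; elim: v f => [|j v IH] f; rewrite ssubst_rec addfE scalefE sumfE.
  by rewrite big1 ?addr0 ?mulr1 // => k _; rewrite mul_nil S0 mul0r.
rewrite [X in _ * X](_ : _ = 0) // mulr0 add0r.
have SE k : (S k * ssubst S (dl k f)) (j :: v) =
    (p j && (q j == k))%:R * ssubst S (dl k f) v.
  rewrite mul_cons S0 mul0r add0r.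
  have -> : dl j (S k) = (p j && (q j == k))%:R *: 1.
    apply: funext => u; rewrite /dl HS scalefE; case: u => [|? ?].
      by rewrite [X in _ * X](_ : _ = 1) // mulr1.
    by rewrite [X in _ * X](_ : _ = 0) // mulr0.
  by rewrite -scalerAl mul1r.
under eq_bigr => k _ do rewrite SE IH.
rewrite /=; case: (p j) => /=; last by rewrite big1 // => k _; rewrite mul0r.
rewrite (bigD1 (q j)) //= eqxx mul1r big1 ?addr0 // => k ki.
by rewrite eq_sym (negbTE ki) mul0r.
Qed.

End Subst.

(** * Derivations *)

Section Derivation.
Variables (R : fieldType) (n : nat).
Implicit Types (f g h : ser R n) (k : 'I_n) (w v : seq 'I_n) (D : 'I_n -> ser R n).

Lemma smonoE N f v : (size v < N)%N -> sextN N (@smono R n) f v = f v.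
Proof.
move=> hv; rewrite sextN_E (bigD1 (Ordinal hv)) //= (bigD1 (in_tuple v)) //=.
rewrite /smono eqxx mulr1 !big1 ?addr0 // => [d|w] neq.
  rewrite big1 // => w _; case: eqP => [E|]; rewrite ?mulr0 //.
  by case/eqP: neq; apply: val_inj; rewrite /= E size_tuple.
case: eqP => [E|]; rewrite ?mulr0 //.
by case/eqP: neq; apply: val_inj; rewrite /= -E.
Qed.

Lemma raising_der_word D : (forall i, D i [::] = 0) -> raising_words (der_word D).
Proof.
move=> D0; elim=> [|k w IH] // v hv.
rewrite -[der_word _ _ _]/((D k * smono w + sgen k * der_word D w) v) addfE.
have H1 : slo (size w) (smono w) (0 : ser R n).
  by move=> u hu; rewrite /smono; case: eqP hu => // ->; rewrite ltnn.
have H2 : slo (size w) (der_word D w) (0 : ser R n) by move=> u; apply: IH.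
rewrite (raising_mull (D0 k) H1 hv) (raising_mull _ H2 hv) ?mulr0 ?addr0 //.
Qed.

Lemma der_rec D f : (forall i, D i [::] = 0) ->
  der_act D f = \sum_k (D k * dl k f + sgen k * der_act D (dl k f)).
Proof.
move=> D0; apply: funext => v.
rewrite [LHS](sext_trunc (N := (size v).+1) f (raising_der_word D0)) //.
rewrite sextN_S [_ *: _](_ : _ = 0); last by apply: funext => u; rewrite scalefE mulr0.
rewrite add0r !sumfE; apply: eq_bigr => k _ /=.
rewrite sextN_add !sextN_mull !addfE.
congr (_ + _).
  by apply: (raising_mull (D0 k) _ (ltnSn (size v))) => u hu; exact: smonoE.
apply: (raising_mull _ _ (ltnSn (size v))) => // u hu.
by apply/esym/sext_trunc => //; exact: raising_der_word.
Qed.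

Lemma der_linr D c f g : der_act D (c *: f + g) = c *: der_act D f + der_act D g.
Proof. exact: sext_lin. Qed.

Lemma der_lin D : lin (der_act D).
Proof. exact/lin_serP/der_linr. Qed.

Lemma derD D f g : der_act D (f + g) = der_act D f + der_act D g.
Proof. by rewrite -[f in LHS]scale1r der_linr scale1r. Qed.
Lemma der0 D : der_act D 0 = 0.
Proof. exact: lin0 (der_lin D). Qed.
Lemma derZ D c f : der_act D (c *: f) = c *: der_act D f.
Proof. by rewrite -[c *: f]addr0 der_linr der0 addr0. Qed.
Lemma derN D f : der_act D (- f) = - der_act D f.
Proof. by rewrite -scaleN1r derZ scaleN1r. Qed.
Lemma derB D f g : der_act D (f - g) = der_act D f - der_act D g.
Proof. by rewrite derD derN. Qed.

Lemma der_nil D f : (forall i, D i [::] = 0) -> der_act D f [::] = 0.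
Proof.
move=> D0; rewrite der_rec // sumfE big1 // => k _.
by rewrite addfE !mul_nil D0 !mul0r addr0.
Qed.

Lemma dl_sgen k j : dl k (sgen j : ser R n) = (k == j)%:R *: 1.
Proof.
apply: funext => w; rewrite /dl /sgen eqseq_cons scalefE.
case: (k == j) => /=; last by rewrite mul0r.
by case: w => [|? ?]; rewrite mul1r.
Qed.

Lemma dl1 k : dl k (1 : ser R n) = 0. Proof. by []. Qed.

Lemma der1 D : (forall i, D i [::] = 0) -> der_act D 1 = 0.
Proof.
by move=> D0; rewrite der_rec // big1 // => k _; rewrite dl1 der0 !mulr0 addr0.
Qed.

Lemma der_sgen D i : (forall i, D i [::] = 0) -> der_act D (sgen i) = D i.
Proof.
move=> D0; rewrite der_rec // (bigD1 i) //= big1 => [|k ki].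
  by rewrite dl_sgen eqxx scale1r der1 // mulr0 mulr1 !addr0.
by rewrite dl_sgen (negbTE ki) scale0r der0 !mulr0 addr0.
Qed.

Lemma der_cons D f j w : (forall i, D i [::] = 0) ->
  der_act D f (j :: w) = (\sum_k D k * dl k f) (j :: w) + der_act D (dl j f) w.
Proof.
move=> D0; rewrite {1}der_rec // big_split /= addfE; congr (_ + _).
rewrite sumfE (bigD1 j) //= big1 => [|k kj]; first by rewrite sgen_mul_cons eqxx addr0.
by rewrite sgen_mul_cons eq_sym (negbTE kj).
Qed.

Lemma der_mul D f g : (forall i, D i [::] = 0) ->
  der_act D (f * g) = der_act D f * g + f * der_act D g.
Proof.
move=> D0; apply: funext => v; elim: v f g => [|j w IH] f g.
  by rewrite addfE !mul_nil !der_nil // mul0r mulr0 addr0.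
rewrite der_cons // dl_mul der_linr addfE scalefE {}IH !addfE.
rewrite !mul_cons der_nil // mul0r add0r.
rewrite [der_act D g (j :: w)]der_cons //.
have -> : \sum_k D k * dl k (f * g) =
   f [::] *: (\sum_k D k * dl k g) + (\sum_k D k * dl k f) * g.
  rewrite scaler_sumr mulr_suml -big_split; apply: eq_bigr => k _ /=.
  by rewrite dl_mul mulrDr -scalerAr mulrA.
have -> : dl j (der_act D f) = dl j (\sum_k D k * dl k f) + der_act D (dl j f).
  by apply: funext => u; rewrite /dl der_cons.
have S0 : (\sum_k D k * dl k f) [::] = 0.
  by rewrite sumfE big1 // => k _; rewrite mul_nil D0 mul0r.
rewrite !addfE scalefE mul_cons S0.
rewrite mul0r add0r mulrDl !addfE; ring.
Qed.

(** No continuity is asked of [Q]: the decomposition by first letters is a finite sum, so linearity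
    and the Leibniz rule already give [Q] the recursion of [der_rec]. *)
Lemma der_uniq D (Q : ser R n -> ser R n) f : (forall i, D i [::] = 0) ->
  (forall c f g, Q (c *: f + g) = c *: Q f + Q g) ->
  (forall f g, Q (f * g) = Q f * g + f * Q g) ->
  (forall k, Q (sgen k) = D k) -> Q f = der_act D f.
Proof.
move=> D0 Ql Qm Qg.
have Q1 : Q 1 = 0.
  by have := Qm 1 1; rewrite !mulr1 mul1r => /eqP; rewrite -subr_eq0 opprD addNKr oppr_eq0 => /eqP.
have Q0 : Q 0 = 0.
  have := Ql (-1) 0 0; rewrite scaler0 addr0 => ->; by rewrite scaleN1r addNr.
have QD f1 f2 : Q (f1 + f2) = Q f1 + Q f2 by rewrite -[f1 in LHS]scale1r Ql scale1r.
have Qrec f' : Q f' = \sum_k (D k * dl k f' + sgen k * Q (dl k f')).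
  rewrite {1}[f']sdecomp Ql Q1 scaler0 add0r (big_morph Q QD Q0).
  by apply: eq_bigr => k _; rewrite Qm Qg.
apply: funext => v; elim: v f => [|j w IH] f.
  rewrite der_nil // Qrec sumfE big1 // => k _.
  by rewrite addfE !mul_nil D0 !mul0r addr0.
rewrite Qrec big_split /= addfE der_cons //; congr (_ + _).
rewrite sumfE (bigD1 j) //= big1 => [|k kj]; first by rewrite sgen_mul_cons eqxx addr0.
by rewrite sgen_mul_cons eq_sym (negbTE kj).
Qed.

Lemma der_comm D D' f : (forall i, D i [::] = 0) -> (forall i, D' i [::] = 0) ->
  der_act D (der_act D' f) - der_act D' (der_act D f) =
  der_act (fun i => der_act D (D' i) - der_act D' (D i)) f.
Proof.
move=> D0 D0'; apply: (der_uniq (Q := fun f => der_act D (der_act D' f) - der_act D' (der_act D f))).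
- by move=> i; rewrite addfE oppfE !der_nil // subr0.
- by move=> c g h; rewrite !der_linr scalerBr opprD addrACA.
- move=> g h; rewrite !(der_mul, derD) // mulrBl mulrBr.
  by apply: funext => w; rewrite !(addfE, oppfE); ring.
- by move=> k; rewrite !der_sgen.
Qed.

Lemma der_linD D D' c f : (forall i, D i [::] = 0) -> (forall i, D' i [::] = 0) ->
  der_act (fun i => c *: D i + D' i) f = c *: der_act D f + der_act D' f.
Proof.
move=> D0 D0'; apply/esym/(der_uniq (Q := fun f => c *: der_act D f + der_act D' f)).
- by move=> i; rewrite addfE scalefE D0 D0' mulr0 addr0.
- by move=> d g h; rewrite !der_linr; apply: funext => w; rewrite !(addfE, scalefE); ring.
- move=> g h; rewrite !der_mul // mulrDl mulrDr scalerDr -scalerAl -scalerAr.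
  by rewrite addrACA.
- by move=> k; rewrite !der_sgen.
Qed.

Lemma eqlo_dl N f g k : slo N.+1 f g -> slo N (dl k f) (dl k g).
Proof. by move=> h v hv; apply: h. Qed.

Lemma eqlo_sum N (I : finType) (F G : I -> ser R n) :
  (forall i, slo N (F i) (G i)) -> slo N (\sum_i F i) (\sum_i G i).
Proof. by move=> h v hv; rewrite !sumfE; apply: eq_bigr => i _; apply: h. Qed.

Lemma eqloD N f f' g g' : slo N f f' -> slo N g g' -> slo N (f + g) (f' + g').
Proof. by move=> h h' v hv; rewrite !addfE h ?h'. Qed.

Lemma der_eqlo D N f g : (forall i, D i [::] = 0) -> slo N f g ->
  slo N (der_act D f) (der_act D g).
Proof.
move=> D0; elim: N f g => // N IH f g h.
rewrite !der_rec //; apply: eqlo_sum => k.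
have hk := eqlo_dl k h.
by apply: eqloD; apply: raising_mull; rewrite ?D0 //; apply: IH.
Qed.

Lemma raising_mull2 f : (forall v, (size v < 2)%N -> f v = 0) ->
  forall N g h, slo N g h -> slo N.+2 (f * g) (f * h).
Proof.
move=> f0 N g h gh [|k v] hv; first by rewrite !mul_nil f0 // !mul0r.
rewrite !mul_cons f0 // !mul0r !add0r.
by apply: (raising_mull _ gh hv); rewrite /dl f0.
Qed.

(** Replacing a letter by terms of degree at least two lengthens words; this is what allows
    tangential derivations to be exponentiated. *)
Lemma der_raising D : (forall i v, (size v < 2)%N -> D i v = 0) ->
  sraising (der_act D).
Proof.
move=> D2; have D0 i : D i [::] = 0 by exact: D2.
elim=> [|N IH] f g h; first by case=> // _; rewrite !der_nil.
rewrite !der_rec //; apply: eqlo_sum => k; have hk := eqlo_dl k h.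
apply: eqloD; first by apply: raising_mull2 => //; exact: D2.
by apply: raising_mull => //; apply: IH.
Qed.

End Derivation.

(** * Lie series *)

Section Lie.
Variables (R : fieldType) (n : nat).
Implicit Types (f g h : ser R n) (k : 'I_n) (w v : seq 'I_n) (D : 'I_n -> ser R n).

(** Words of mixed length are allowed, so closure properties need no grading; [is_lieP] returns to
    the graded definition. *)
Definition lie_poly f := exists s : seq (R * seq 'I_n),
  f = \sum_(p <- s) p.1 *: lbr p.2.

Lemma lbr_cons2 k j w : lbr (k :: j :: w) = sgen k * lbr (j :: w) - lbr (j :: w) * sgen k :> ser R n.
Proof. by []. Qed.

Lemma lbr_size w v : size v != size w -> lbr w v = 0 :> R.
Proof.
elim: w v => [|k [|j w] IH] v //.
  by rewrite [lbr _]/(sgen k) /sgen; case: (v =P [:: k]) => // ->.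
rewrite lbr_cons2 addfE oppfE => hv.
case: v hv => [|i v] hv; first by rewrite !mul_nil {1}/sgen mul0r /sgen mulr0 subr0.
rewrite sgen_mul_cons IH ?if_same ?add0r //.
case/lastP: v hv => [|v l] hv.
  by rewrite mul_cons IH // mul0r add0r mul_nil [sgen k [::]](_ : _ = 0) // mulr0 oppr0.
have -> : i :: rcons v l = rcons (i :: v) l by [].
rewrite -smulE smul_rcons [sgen k [::]](_ : _ = 0) // mulr0 addr0.
rewrite sdiff_sgen smulE -scalerAr mulr1 scalefE IH ?mulr0 ?oppr0 //.
by move: hv; rewrite /= size_rcons.
Qed.

Lemma lie_poly0 : lie_poly 0.
Proof. by exists [::]; rewrite big_nil. Qed.

Lemma lie_polyD f g : lie_poly f -> lie_poly g -> lie_poly (f + g).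
Proof. by move=> [s ->] [t ->]; exists (s ++ t); rewrite big_cat. Qed.

Lemma lie_polyZ c f : lie_poly f -> lie_poly (c *: f).
Proof.
move=> [s ->]; exists [seq (c * p.1, p.2) | p <- s].
by rewrite big_map scaler_sumr; apply: eq_bigr => p _; rewrite scalerA.
Qed.

Lemma lie_polyN f : lie_poly f -> lie_poly (- f).
Proof. by rewrite -scaleN1r; apply: lie_polyZ. Qed.

Lemma lie_poly_lbr w : lie_poly (lbr w).
Proof. by exists [:: (1, w)]; rewrite big_seq1 scale1r. Qed.

Lemma lie_poly_sum (I : Type) (s : seq I) (F : I -> ser R n) :
  (forall i, lie_poly (F i)) -> lie_poly (\sum_(i <- s) F i).
Proof.
by move=> h; elim/big_rec: _ => [|i x _ hx]; [apply: lie_poly0|apply: lie_polyD].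
Qed.

Lemma sbr_sumr (I : Type) (s : seq I) (F : I -> ser R n) f :
  sbr f (\sum_(i <- s) F i) = \sum_(i <- s) sbr f (F i).
Proof. by rewrite sbrE mulr_sumr mulr_suml -sumrB. Qed.

Lemma sbr_suml (I : Type) (s : seq I) (F : I -> ser R n) f :
  sbr (\sum_(i <- s) F i) f = \sum_(i <- s) sbr (F i) f.
Proof. by rewrite sbrE mulr_sumr mulr_suml -sumrB. Qed.

Lemma sbrZr c f g : sbr f (c *: g) = c *: sbr f g.
Proof. by rewrite !sbrE -scalerAl -scalerAr scalerBr. Qed.

Lemma sbrZl c f g : sbr (c *: f) g = c *: sbr f g.
Proof. by rewrite !sbrE -scalerAl -scalerAr scalerBr. Qed.

Lemma lie_poly_sbr_gen k f : lie_poly f -> lie_poly (sbr (sgen k) f).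
Proof.
move=> [s ->]; rewrite sbr_sumr; apply: lie_poly_sum => -[c w] /=.
rewrite sbrZr; apply: lie_polyZ; case: w => [|j w].
  by rewrite [lbr _](_ : _ = 0) // sbrE mulr0 mul0r subr0; apply: lie_poly0.
by rewrite -[sbr _ _]/(lbr (k :: j :: w)); exact: lie_poly_lbr.
Qed.

(** The Jacobi identity [[x, p], g] = [x, [p, g]] - [p, [x, g]] shortens the left factor, for all
    [g] at once. *)
Lemma lie_poly_sbr_lbr w g : lie_poly g -> lie_poly (sbr (lbr w) g).
Proof.
elim: w g => [|k [|j w] IH] g hg.
- by rewrite [lbr _](_ : _ = 0) // sbrE mulr0 mul0r subr0; apply: lie_poly0.
- exact: lie_poly_sbr_gen.
set p := lbr (j :: w) in IH *.
have -> : sbr (lbr (k :: j :: w)) g =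
    sbr (sgen k) (sbr p g) - sbr p (sbr (sgen k) g).
  rewrite lbr_cons2 -/p !sbrE !(mulrBl, mulrBr, mulrA).
  by apply: funext => u; rewrite !(addfE, oppfE); ring.
apply: lie_polyD; first by apply/lie_poly_sbr_gen/IH.
by apply/lie_polyN/IH/lie_poly_sbr_gen.
Qed.

Lemma lie_poly_sbr f g : lie_poly f -> lie_poly g -> lie_poly (sbr f g).
Proof.
move=> [s ->] hg; rewrite sbr_suml; apply: lie_poly_sum => -[c w] /=.
by rewrite sbrZl; apply/lie_polyZ/lie_poly_sbr_lbr.
Qed.

Lemma sum_shom N f : slo N f (\sum_(d < N) shom d f).
Proof.
move=> v hv; rewrite sumfE (bigD1 (Ordinal hv)) //= big1 ?addr0 => [|d hd].
  by rewrite /shom eqxx.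
rewrite /shom; case: eqP => // E; case/eqP: hd; exact/val_inj.
Qed.

Lemma is_lieP f : is_lie f <-> forall N, exists g, lie_poly g /\ slo N f g.
Proof.
split=> [hf N|hf d].
  exists (\sum_(d < N) shom d f); split; last exact: sum_shom.
  apply: lie_poly_sum => d; case: (hf d) => c /funext ->.
  exists [seq (c t, val t) | t <- enum {: d.-tuple 'I_n}].
  by apply: funext => v; rewrite big_map big_enum sumfE; apply: eq_bigr.
case: (hf d.+1) => g [[s ->] hg].
(* A word may occur several times in [s]; its coefficients are added up, and words of other lengths
   are dropped. *)
exists (fun t : d.-tuple _ => \sum_(p <- s | p.2 == t) p.1) => v.
have -> : \sum_(t : d.-tuple 'I_n) (\sum_(p <- s | p.2 == t) p.1) * lbr t v =
    \sum_(p <- s) if size p.2 == d then p.1 * lbr p.2 v else 0.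
  under eq_bigr => t _ do rewrite mulr_suml.
  rewrite (exchange_big_dep xpredT) //=; apply: eq_bigr => p _.
  case: eqP => [E|ne].
    by rewrite (big_pred1 (Tuple (introT eqP E))) // => t /=; rewrite -val_eqE eq_sym.
  by rewrite big1 // => t /eqP E; case: ne; rewrite E size_tuple.
rewrite /shom; case: eqP => [hv|hv].
  rewrite hg ?hv // sumfE; apply: eq_bigr => p _; rewrite scalefE.
  by case: eqP => // ne; rewrite lbr_size ?mulr0 // hv eq_sym; apply/eqP.
rewrite big1 // => p _; case: eqP => // E.
by rewrite lbr_size ?mulr0 // E; apply/eqP.
Qed.

Lemma lie_poly_is_lie f : lie_poly f -> is_lie f.
Proof. by move=> hf; apply/is_lieP => N; exists f. Qed.

Lemma is_lie_lim f : (forall N, exists g, is_lie g /\ slo N f g) -> is_lie f.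
Proof.
move=> h; apply/is_lieP => N; case: (h N) => g [/is_lieP/(_ N) [g' [hg' E']] E].
by exists g'; split=> // v hv; rewrite E // E'.
Qed.

Lemma is_lie_lin c f g : is_lie f -> is_lie g -> is_lie (c *: f + g).
Proof.
move=> /is_lieP hf /is_lieP hg; apply/is_lieP => N.
case: (hf N) (hg N) => f' [hf' Ef] [g' [hg' Eg]].
exists (c *: f' + g'); split; first exact/lie_polyD/hg'/lie_polyZ.
by move=> v hv; rewrite !addfE !scalefE Ef ?Eg.
Qed.

Lemma is_lie0 : is_lie (0 : ser R n).
Proof. exact/lie_poly_is_lie/lie_poly0. Qed.

Lemma is_lieD f g : is_lie f -> is_lie g -> is_lie (f + g).
Proof. by rewrite -{2}[f]scale1r; apply: is_lie_lin. Qed.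

Lemma is_lieZ c f : is_lie f -> is_lie (c *: f).
Proof. by move=> hf; rewrite -[_ *: _]addr0; apply: is_lie_lin => //; apply: is_lie0. Qed.

Lemma is_lieN f : is_lie f -> is_lie (- f).
Proof. by rewrite -scaleN1r; apply: is_lieZ. Qed.

Lemma is_lieB f g : is_lie f -> is_lie g -> is_lie (f - g).
Proof. by move=> hf hg; apply/is_lieD/is_lieN. Qed.

Lemma is_lie_sum (I : Type) (s : seq I) (F : I -> ser R n) :
  (forall i, is_lie (F i)) -> is_lie (\sum_(i <- s) F i).
Proof.
by move=> h; elim/big_rec: _ => [|i x _ hx]; [apply: is_lie0|apply: is_lieD].
Qed.

Lemma is_lie_sgen k : is_lie (sgen k : ser R n).
Proof. exact/lie_poly_is_lie/(lie_poly_lbr [:: k]). Qed.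

Lemma is_lie_sbr f g : is_lie f -> is_lie g -> is_lie (sbr f g).
Proof.
move=> /is_lieP hf /is_lieP hg; apply/is_lieP => N.
case: (hf N) (hg N) => f' [hf' Ef] [g' [hg' Eg]].
exists (sbr f' g'); split; first exact: lie_poly_sbr.
by rewrite !sbrE => v hv; rewrite !addfE !oppfE (slo_mul Ef Eg) ?(slo_mul Eg Ef).
Qed.

Lemma is_lie_nil f : is_lie f -> f [::] = 0.
Proof.
move=> /is_lieP/(_ 1%N) [g [[s ->] /(_ [::] isT) ->]].
rewrite sumfE big1 // => -[c w] _; rewrite scalefE /=.
case: w => [|k w]; first by rewrite [lbr _ _](_ : _ = 0) // mulr0.
by rewrite lbr_size ?mulr0.
Qed.

Lemma is_lie_shom d f : is_lie f -> is_lie (shom d f).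
Proof.
move=> hf; case: (hf d) => c /funext ->; apply: lie_poly_is_lie.
exists [seq (c t, val t) | t <- enum {: d.-tuple 'I_n}].
by apply: funext => v; rewrite big_map big_enum sumfE; apply: eq_bigr.
Qed.

Lemma is_lie_opser c P f : lin P -> sraising P ->
  (forall g, is_lie g -> is_lie (P g)) -> is_lie f -> is_lie (opser size c P f : ser R n).
Proof.
move=> Pl Pr PL hf; apply: is_lie_lim => N.
exists (\sum_(k < N.+1) c k *: (iter k P f : ser R n)); split.
  apply: is_lie_sum => k; apply: is_lieZ; elim: (k : nat) => //= m; exact: PL.
move=> v hv; rewrite (@opser_trunc _ _ _ c P f N) // ?(ltnW hv) //.
by rewrite sumfE; apply: eq_bigr.
Qed.

(** Degrees may be rescaled independently; the weights m and 1/m give the Euler derivation and its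
    inverse in positive degree. *)
Lemma is_lie_weight (c : nat -> R) f : is_lie f ->
  is_lie ((fun v => c (size v) * f v) : ser R n).
Proof.
move=> hf; apply: is_lie_lim => N; exists (\sum_(d < N) c d *: shom d f); split.
  by apply: is_lie_sum => d; apply/is_lieZ/is_lie_shom.
move=> v hv; rewrite sumfE (bigD1 (Ordinal hv)) //= big1 ?addr0 => [|d hd].
  by rewrite scalefE /shom eqxx.
rewrite scalefE /shom; case: eqP => [E|]; rewrite ?mulr0 //.
by case/eqP: hd; exact/val_inj.
Qed.

Lemma is_lie_der D f : (forall i, D i [::] = 0) -> (forall i, is_lie (D i)) ->
  is_lie f -> is_lie (der_act D f).
Proof.
move=> D0 DL /is_lieP hf; apply: is_lie_lim => N.
case: (hf N) => g [[s ->] E]; eexists; split; last exact: der_eqlo E.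
rewrite (big_morph (der_act D) (derD D) (der0 D)).
apply: is_lie_sum => -[c w] /=; rewrite derZ; apply: is_lieZ.
elim: w => [|k [|j w] IH]; first by rewrite [lbr _](_ : _ = 0) // der0; apply: is_lie0.
  by rewrite /= der_sgen.
set p := lbr (j :: w) in IH *.
rewrite lbr_cons2 -/p derB !der_mul // der_sgen //.
have -> : D k * p + sgen k * der_act D p - (der_act D p * sgen k + p * D k) =
   sbr (D k) p + sbr (sgen k) (der_act D p).
  by rewrite !sbrE; apply: funext => u; rewrite !(addfE, oppfE); ring.
apply: is_lieD; first by apply: is_lie_sbr => //; apply/lie_poly_is_lie/lie_poly_lbr.
exact/is_lie_sbr/IH/is_lie_sgen.
Qed.

End Lie.

(** * Cyclic words *)

Section Trace.
Variables (R : fieldType) (n : nat).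
Implicit Types (f g h : ser R n) (k : 'I_n) (w v : seq 'I_n) (D : 'I_n -> ser R n).

(* The coordinates of the class of f in tr_n: sums over rotations of a word. *)
Definition tau f : ser R n :=
  fun w => if w is [::] then f w else \sum_(i < size w) f (rot i w).

Lemma tau_lin c f g : tau (c *: f + g) = c *: tau f + tau g.
Proof.
apply: funext => -[|k w] //; rewrite addfE scalefE /tau mulr_sumr -big_split.
exact: eq_bigr.
Qed.

Lemma tau0 : tau 0 = 0.
Proof. by have := tau_lin (-1) 0 0; rewrite scaler0 addr0 scaleN1r addNr. Qed.
Lemma tauD f g : tau (f + g) = tau f + tau g.
Proof. by rewrite -[f in LHS]scale1r tau_lin scale1r. Qed.
Lemma tauZ c f : tau (c *: f) = c *: tau f.
Proof. by rewrite -[c *: f]addr0 tau_lin tau0 addr0. Qed.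
Lemma tauN f : tau (- f) = - tau f.
Proof. by rewrite -scaleN1r tauZ scaleN1r. Qed.
Lemma tauB f g : tau (f - g) = tau f - tau g.
Proof. by rewrite tauD tauN. Qed.
Lemma tau_sum (I : Type) (s : seq I) (F : I -> ser R n) :
  tau (\sum_(i <- s) F i) = \sum_(i <- s) tau (F i).
Proof. exact: (big_morph tau tauD tau0). Qed.

Lemma tau_eqlo N f g : slo N f g -> slo N (tau f) (tau g).
Proof.
move=> h [|k w] hw; first by rewrite /tau h.
by apply: eq_bigr => i _; apply: h; rewrite size_rot.
Qed.

Lemma sum_rot1 (K : seq 'I_n -> R) w :
  \sum_(i < size w) K (rot 1 (rot i w)) = \sum_(i < size w) K (rot i w).
Proof.
case E : (size w) => [|m]; first by rewrite !big_ord0.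
rewrite big_ord_recr [RHS]big_ord_recl /= addrC.
rewrite -rotD ?add1n ?E // -E rot_size rot0; congr (_ + _).
by apply: eq_bigr => i _; rewrite -rotD ?add1n ?E // ltnS ltnW.
Qed.

Lemma sum_rot (K : seq 'I_n -> R) w j : (j <= size w)%N ->
  \sum_(i < size w) K (rot j (rot i w)) = \sum_(i < size w) K (rot i w).
Proof.
elim: j K => [|j IH] K hj; first by under eq_bigr do rewrite rot0.
rewrite -IH 1?ltnW // -(sum_rot1 (fun u => K (rot j u))).
by apply: eq_bigr => i _; rewrite -[RHS]/(K (rot j _)) -(@rotD _ j 1) ?addn1 ?size_rot.
Qed.

(** A word cut at j and rotated by j is the exchanged pair of pieces, cut at the complementary
    position; the sum over all rotations absorbs the extra rotation. *)
Lemma tau_mulC f g : tau (f * g) = tau (g * f).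
Proof.
apply: funext => -[|k w]; first by rewrite /tau !mul_nil mulrC.
rewrite /tau -!smulE; set u := k :: w.
pose F j v := f (take j v) * g (drop j v).
transitivity (\sum_(j < (size u).+1) \sum_(i < size u) F j (rot i u)).
  rewrite exchange_big; apply: eq_bigr => i _; rewrite /smul size_rot.
  exact: eq_bigr.
transitivity (\sum_(j < (size u).+1)
    \sum_(i < size u) g (take (size u - j) (rot i u)) * f (drop (size u - j) (rot i u))).
  apply: eq_bigr => j _.
  pose K v := g (take (size u - j) v) * f (drop (size u - j) v).
  transitivity (\sum_(i < size u) K (rot j (rot i u))); last first.
    by apply: sum_rot; rewrite -ltnS.
  apply: eq_bigr => i _; rewrite /F /K mulrC.
  have sE : size (drop j (rot i u)) = (size u - j)%N by rewrite size_drop size_rot.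
  by rewrite /(rot j) -sE take_size_cat // drop_size_cat.
rewrite exchange_big; apply: eq_bigr => i _; rewrite /smul size_rot.
rewrite [RHS](reindex_inj rev_ord_inj) /=.
by apply: eq_bigr => j _; rewrite subSS.
Qed.

Lemma tau_sbr f g : tau (sbr f g) = 0.
Proof. by rewrite sbrE tauB tau_mulC subrr. Qed.

Lemma smono_mul w v : smono w * smono v = smono (w ++ v) :> ser R n.
Proof.
elim: w => [|k w IH].
  by rewrite [smono [::]](_ : _ = 1) ?mul1r //; apply: funext => -[].
have mc u : smono (k :: u) = sgen k * smono u :> ser R n.
  apply: funext => -[|j u']; rewrite ?sgen_mul_nil // sgen_mul_cons /smono eqseq_cons.
  by case: eqP.
by rewrite cat_cons !mc -mulrA IH.
Qed.

Lemma shom_smono d f : shom d f = \sum_(t : d.-tuple 'I_n) f t *: smono t.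
Proof.
apply: funext => v; rewrite /shom sumfE; case: eqP => [E|ne].
  rewrite (bigD1 (Tuple (introT eqP E))) //= big1 => [|t ht].
    by rewrite scalefE /smono eqxx mulr1 addr0.
  rewrite scalefE /smono; case: eqP => [E'|]; rewrite ?mulr0 //.
  by case/eqP: ht; apply: val_inj; rewrite /= E'.
rewrite big1 // => t _; rewrite scalefE /smono; case: eqP => [E|]; rewrite ?mulr0 //.
by case: ne; rewrite E size_tuple.
Qed.

Hypothesis char0 : [pchar R] =i pred0.

Lemma natS_neq0 m : m.+1%:R != 0 :> R.
Proof. by have /pcharf0P -> := char0. Qed.

(** A rotated monomial minus the monomial is the commutator of its two pieces. Averaging over the
    d+1 rotations, which needs characteristic zero, writes the component as commutators plus
    monomials weighted by values of [tau f]. *)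
Lemma tau0_shom d f : tau f = 0 -> exists s : seq (ser R n * ser R n),
  shom d f = \sum_(p <- s) sbr p.1 p.2.
Proof.
move=> tf; case: d => [|d].
  exists [::]; rewrite big_nil; apply: funext => -[|k v] //.
  by have := congr1 (fun h => h [::]) tf.
exists (map (fun p : d.+1.-tuple 'I_n * 'I_d.+1 =>
    ((d.+1%:R^-1 * f (rot p.2 p.1)) *: smono (drop p.2 p.1) : ser R n,
     smono (take p.2 p.1) : ser R n)) (enum {: d.+1.-tuple 'I_n * 'I_d.+1})).
rewrite big_map big_enum /=.
have E : forall p : d.+1.-tuple 'I_n * 'I_d.+1,
   sbr (d.+1%:R^-1 * f (rot p.2 p.1) *: smono (drop p.2 p.1)) (smono (take p.2 p.1))
   = d.+1%:R^-1 *: (f (rot p.2 p.1) *: smono (rot p.2 p.1) - f (rot p.2 p.1) *: smono p.1).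
  move=> p; rewrite sbrE -scalerAl -scalerAr !smono_mul cat_take_drop -scalerBr.
  by rewrite -scalerBr scalerA.
under eq_bigr => p _ do rewrite E.
rewrite -scaler_sumr sumrB.
rewrite -(pair_bigA _ (fun (t : d.+1.-tuple 'I_n) (i : 'I_d.+1) =>
  f (rot i t) *: (smono (rot i t) : ser R n))).
rewrite -(pair_bigA _ (fun (t : d.+1.-tuple 'I_n) (i : 'I_d.+1) =>
  f (rot i t) *: (smono t : ser R n))) /=.
rewrite [X in _ - X]big1 ?subr0 => [|t _].
  rewrite exchange_big /= (eq_bigr (fun _ => shom d.+1 f)) => [|i _].
    rewrite sumr_const card_ord -scaler_nat scalerA mulVf ?scale1r //.
    exact: natS_neq0.
  rewrite shom_smono.
  rewrite [RHS](reindex (fun t : d.+1.-tuple 'I_n => [tuple of rot i t])) //=.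
  exists (fun t : d.+1.-tuple 'I_n => [tuple of rotr i t]) => t _; apply: val_inj => /=.
    exact: rotK.
  exact: rotrK.
rewrite -scaler_suml; have := congr1 (fun h => h (val t)) tf.
case: t => -[|k t] //= ht; rewrite (eqP (ht : _ == _)) => ->.
by rewrite scale0r.
Qed.

Lemma ssumE (s : seq (ser R n)) : ssum s = \sum_(f <- s) f.
Proof. by elim: s => [|f s IH] /=; rewrite ?big_nil // big_cons -IH. Qed.

Lemma shom_id d f : shom d (shom d f) = shom d f.
Proof. by apply: funext => v; rewrite /shom; case: eqP. Qed.

Lemma trzP f : trz f <-> tau f = 0.
Proof.
split=> [tf|tf d].
  apply: funext => w; case: (tf (size w)) => s E.
  have {}E : forall u, size u = size w -> f u = (\sum_(p <- s) sbr p.1 p.2) u.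
    by move=> u hu; have := E u; rewrite /shom hu eqxx ssumE big_map.
  transitivity (tau (\sum_(p <- s) sbr p.1 p.2) w).
    case: w E => [|k w] E; first exact: E.
    by apply: eq_bigr => i _; apply: E; rewrite size_rot.
  by rewrite tau_sum big1 // => p _; rewrite tau_sbr.
case: (tau0_shom d tf) => s E; exists s => v.
by rewrite ssumE big_map -E shom_id.
Qed.

Lemma tr_eqP f g : tr_eq f g <-> tau f = tau g.
Proof.
rewrite /tr_eq trzP ssubE tauB; split=> [/eqP|->]; last by rewrite subrr.
by rewrite subr_eq0 => /eqP.
Qed.

(** A derivation maps a commutator to a sum of two commutators; up to any given degree, [f] is a
    finite list of commutators. *)
Lemma tau_der D f : (forall i, D i [::] = 0) -> tau f = 0 -> tau (der_act D f) = 0.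
Proof.
move=> D0 tf; apply: funext => w; set N := (size w).+1.
have [s E] : exists s : seq (ser R n * ser R n),
    \sum_(d < N) shom d f = \sum_(p <- s) sbr p.1 p.2.
  elim: N => [|N [s IH]]; first by exists [::]; rewrite big_ord0 big_nil.
  case: (tau0_shom N tf) => t E; exists (s ++ t).
  by rewrite big_ord_recr /= IH E big_cat.
have Ef : slo N f (\sum_(p <- s) sbr p.1 p.2).
  by rewrite -E; apply: sum_shom.
rewrite (tau_eqlo (der_eqlo D0 Ef) (ltnSn _)) (big_morph _ (derD D) (der0 D)).
rewrite tau_sum big1 // => p _; rewrite sbrE derB !der_mul // tauB !tauD.
by rewrite [tau (p.2 * _)]tau_mulC [tau (_ * p.1)]tau_mulC [X in _ - X]addrC subrr.
Qed.

Lemma tau_opser c P f : (forall g, tau g = 0 -> tau (P g) = 0) ->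
  tau f = 0 -> tau (opser size c P f) = 0.
Proof.
move=> HP tf; apply: funext => w.
have tk (m : nat) : tau (iter m P f) = 0.
  by elim: m => [|m IH]; [exact: tf|exact: (HP _ IH)].
transitivity (tau (\sum_(k < (size w).+1) c k *: (iter k P f : ser R n)) w).
  case: w => [|k w]; first by rewrite /tau sumfE.
  by apply: eq_bigr => i _; rewrite sumfE /opser size_rot.
by rewrite tau_sum big1 // => k _; rewrite tauZ tk scaler0.
Qed.

End Trace.

(** * The Baker-Campbell-Hausdorff theorem *)

(** Cauchy product of truncated series: the terms of the square beyond the antidiagonal N vanish. *)
Lemma sum_triangle (R : nmodType) (F : nat -> nat -> R) N :
  (forall i j, (N < i + j)%N -> F i j = 0) ->
  \sum_(i < N.+1) \sum_(j < N.+1) F i j =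
  \sum_(n < N.+1) \sum_(k < n.+1) F (n - k)%N k.
Proof.
move=> F0; rewrite exchange_big /=.
transitivity (\sum_(k < N.+1) \sum_(n < N.+1 | (k <= n)%N) F (n - k)%N k); last first.
  rewrite (exchange_big_dep xpredT) //=; apply: eq_bigr => n _.
  by rewrite [RHS](big_ord_widen N.+1 (fun k => F (n - k)%N k)).
apply: eq_bigr => k _.
rewrite -(big_mkord (fun n => k <= n)%N (fun n => F (n - k)%N k)).
rewrite -(big_mkord xpredT (fun i => F i k)).
rewrite [RHS](big_cat_nat (n := k)) //= 1?ltnW //.
rewrite [X in _ = X + _]big_nat_cond [X in _ = X + _]big1 ?add0r; last by move=> i; lia.
rewrite -{2}[val k]add0n big_addn [LHS](big_cat_nat (n := (N.+1 - k)%N)) ?leq_subr //=.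
rewrite [X in _ + X]big_nat_cond [X in _ + X]big1 ?addr0; last first.
  move=> i; case/andP => /andP[h _] _; apply: F0; have := ltn_ord k; lia.
by apply: eq_big => i; rewrite ?leq_addl // addnK.
Qed.

Lemma pascal_sum (R : pzRingType) (V : lmodType R) (G : nat -> V) n :
  \sum_(k < n.+2) 'C(n.+1, k)%:R *: G k =
  \sum_(k < n.+1) 'C(n, k)%:R *: G k + \sum_(k < n.+1) 'C(n, k)%:R *: G k.+1.
Proof.
rewrite big_ord_recl.
under eq_bigr => k _ do rewrite binS natrD scalerDl.
rewrite big_split addrA; congr (_ + _); rewrite /= !bin0.
rewrite [RHS]big_ord_recl bin0; congr (_ + _).
by rewrite big_ord_recr /= bin_small // scale0r addr0.
Qed.

Section BCH.
Variables (R : fieldType) (n : nat).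
Hypothesis char0 : [pchar R] =i pred0.
Implicit Types (f g h d w z l : ser R n) (v : seq 'I_n) (c : nat -> R).

Lemma fact_neq0 m : m`!%:R != 0 :> R.
Proof. by case: (m`!) (fact_gt0 m) => // k _; apply: natS_neq0. Qed.

Lemma expc_bin m k : (k <= m)%N ->
  (expc m : R) * 'C(m, k)%:R = expc (m - k)%N * expc k.
Proof.
move=> km; rewrite /expc; apply: (mulfI (fact_neq0 m)).
rewrite mulrA mulfV ?fact_neq0 // mul1r -(bin_fact km) !natrM.
by field; rewrite !fact_neq0.
Qed.

Lemma mul_pow_ad d w m :
  d * w ^+ m = \sum_(k < m.+1) 'C(m, k)%:R *: (w ^+ (m - k)%N * iter k (ad w) d).
Proof.
elim: m d => [|m IH] d; first by rewrite big_ord1 /= scale1r mulr1 mul1r.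
rewrite (pascal_sum (fun k => w ^+ (m.+1 - k) * iter k (ad w) d)).
have -> : d * w ^+ m.+1 = w * (d * w ^+ m) + ad w d * w ^+ m.
  by rewrite exprS /ad mulrBl !mulrA addrC subrK.
rewrite !IH mulr_sumr; congr (_ + _); apply: eq_bigr => k _.
  by rewrite -scalerAr mulrA -exprS subSn // -ltnS.
by rewrite subSS -iterSr.
Qed.

(** The left side is the derivative of w^(m+1) in the direction d. Moving d to the right by
    [mul_pow_ad] produces binomials that add up by Pascal's rule. *)
Lemma sum_pow_ad d w m :
  \sum_(i < m.+1) w ^+ i * d * w ^+ (m - i) =
  \sum_(k < m.+1) 'C(m.+1, k.+1)%:R *: (w ^+ (m - k)%N * iter k (ad w) d).
Proof.
elim: m => [|m IH]; first by rewrite !big_ord1 /= scale1r subnn expr0 !mul1r mulr1.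
under [RHS]eq_bigr => k _ do rewrite binS natrD scalerDl.
rewrite [RHS]big_split [RHS]addrC [LHS]big_ord_recl; congr (_ + _).
  by rewrite mul1r subn0 mul_pow_ad.
rewrite [RHS]big_ord_recr /= bin_small // scale0r addr0.
transitivity (w * \sum_(i < m.+1) w ^+ i * d * w ^+ (m - i)).
  by rewrite mulr_sumr; apply: eq_bigr => i _; rewrite subSS exprS !mulrA.
rewrite IH mulr_sumr; apply: eq_bigr => k _.
by rewrite -scalerAr mulrA -exprS subSn // -ltnS.
Qed.

Definition eul f : ser R n := fun v => (size v)%:R * f v.

Lemma eul_mul f g : eul (f * g) = eul f * g + f * eul g.
Proof.
apply: funext => v; rewrite addfE -!smulE /smul {1}/eul mulr_sumr -big_split.
apply: eq_bigr => i _ /=; rewrite /eul.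
have hi : (i <= size v)%N by rewrite -ltnS.
rewrite size_takel // size_drop -{1}(subnKC hi) natrD; ring.
Qed.



Lemma eul_pow w m : eul (w ^+ m.+1) = \sum_(i < m.+1) w ^+ i * eul w * w ^+ (m - i).
Proof.
elim: m => [|m IH]; first by rewrite big_ord1 mul1r mulr1.
rewrite exprS eul_mul IH [RHS]big_ord_recl mul1r subn0; congr (_ + _).
by rewrite mulr_sumr; apply: eq_bigr => i _; rewrite subSS exprS !mulrA.
Qed.

Definition expo f : ser R n := ps_eval expc f.

Lemma pow_ad_small w d i j v : w [::] = 0 -> (size v < i + j)%N ->
  (w ^+ i * iter j (ad w) d) v = 0.
Proof.
move=> w0 hv.
have E z : w ^+ i * z = iter i (fun g => w * g) z.
  by elim: i {hv} => [|i IH]; rewrite ?mul1r // exprS -mulrA IH.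
have h0 : slo 0 d (0 : ser R n) by [].
have := raising_iter (k := i) (raising_mull w0) (raising_iter (k := j) (raising_ad w0) h0).
move=> /(_ v); rewrite add0n addnC E => -> //.
rewrite (lin0 (lin_iter j (lin_ad w))).
by rewrite (lin0 (lin_iter i (lin_mull w))).
Qed.

(** Common normal form, powers of [w] followed by iterated brackets, in which [eul_expo] and
    [mul_expo] are compared term by term. *)
Lemma expo_mul_opser c w d v : w [::] = 0 ->
  (expo w * opser size c (ad w) d) v = \sum_(m < (size v).+1) \sum_(k < m.+1)
     expc (m - k)%N * c k * (w ^+ (m - k)%N * iter k (ad w) d) v.
Proof.
move=> w0; set N := size v.
have H1 : slo N.+1 (expo w) (\sum_(i < N.+1) expc i *: w ^+ i).
  by move=> u hu; apply: ps_eval_trunc.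
have H2 : slo N.+1 (opser size c (ad w) d) (\sum_(j < N.+1) c j *: (iter j (ad w) d : ser R n)).
  move=> u hu; rewrite sumfE.
  exact: (@opser_trunc _ _ _ c (ad w) d N u (lin_ad w) (raising_ad w0)).
rewrite (slo_mul H1 H2) //.
rewrite -(sum_triangle (F := fun i j => expc i * c j * (w ^+ i * iter j (ad w) d) v)).
  rewrite mulr_suml sumfE; apply: eq_bigr => i _; rewrite mulr_sumr sumfE.
  by apply: eq_bigr => j _; rewrite -scalerAl -scalerAr scalerA scalefE.
by move=> i j hij; rewrite pow_ad_small ?mulr0.
Qed.

(** Derivative of the exponential: E(e^w) = e^w ((e^z - 1)/z)(E w) at z = [ad w]. *)
Lemma eul_expo w : w [::] = 0 ->
  eul (expo w) = expo w * opser size (fun k => expc k.+1) (ad w) (eul w).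
Proof.
move=> w0; apply: funext => v; rewrite expo_mul_opser // /eul.
rewrite {1}/expo (@ps_eval_trunc _ _ expc w (size v).+1) // big_ord_recl addfE sumfE mulrDr.
rewrite [_ * _](_ : _ = 0) ?add0r; last first.
  by case: v => [|k v]; rewrite ?mul0r // scalefE [X in _ * X](_ : _ = 0) ?mulr0.
rewrite mulr_sumr; apply: eq_bigr => m _.
rewrite scalefE mulrCA -[_%:R * _]/(eul _ v) eul_pow sum_pow_ad sumfE mulr_sumr.
apply: eq_bigr => k _; rewrite scalefE mulrA; congr (_ * _).
by have := @expc_bin m.+1 k.+1 (ltn_ord k); rewrite subSS => <-.
Qed.

Lemma mul_expo l w : w [::] = 0 ->
  l * expo w = expo w * opser size expc (ad w) l.
Proof.
move=> w0; apply: funext => v; rewrite expo_mul_opser //.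
have H1 : slo (size v).+1 (expo w) (\sum_(i < (size v).+1) expc i *: w ^+ i).
  by move=> u hu; apply: ps_eval_trunc.
rewrite (slo_mul (fun _ _ => erefl) H1) // mulr_sumr sumfE.
apply: eq_bigr => m _; rewrite -scalerAr mul_pow_ad scalefE sumfE mulr_sumr.
by apply: eq_bigr => k _; rewrite scalefE mulrA expc_bin // -ltnS.
Qed.

Lemma expo_nil w : expo w [::] = 1.
Proof. by rewrite /expo /ps_eval big_ord1 /expc /= invr1 mul1r. Qed.

Lemma eul_uniq g g' l : l [::] = 0 -> g [::] = g' [::] ->
  eul g = g * l -> eul g' = g' * l -> g = g'.
Proof.
move=> l0 gg E E'; apply: (@eqlo_all _ _ size); elim=> // N IH v hv.
have := raising_mulr l0 IH hv; rewrite -E -E' /eul.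
case: v hv => [|k v] // hv; exact: (mulfI (natS_neq0 char0 _)).
Qed.

(** Neither argument has a constant term, so a discrepancy in one factor is multiplied by positive
    degree. The gain of one degree makes the iteration for [w] converge. *)
Lemma slo_ad N f f' g g' : f [::] = 0 -> f' [::] = 0 -> g [::] = 0 -> g' [::] = 0 ->
  slo N f f' -> slo N g g' -> slo N.+1 (ad f g) (ad f' g').
Proof.
move=> f0 f0' g0 g0' hf hg v hv; rewrite /ad !addfE !oppfE.
rewrite (raising_mull f0 hg hv) (raising_mulr g0' hf hv).
by rewrite (raising_mull g0 hf hv) (raising_mulr f0' hg hv).
Qed.

Lemma expo_lie_ode l : is_lie l -> exists w, is_lie w /\
  opser size (fun k => expc k.+1) (ad w) (eul w) = l.
Proof.
move=> Ll; pose Phi w : ser R n := opser size (fun k => expc k.+1) (ad w) (eul w).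
have LPhi w : is_lie w -> is_lie (Phi w).
  move=> hw; apply: is_lie_opser; [exact: lin_ad|exact/raising_ad/is_lie_nil| |].
    by move=> g hg; rewrite /ad -sbrE; apply: is_lie_sbr.
  exact: (is_lie_weight (fun m => m%:R)).
(* Phi w = l is solved for its leading term E(w), so its solutions are fixed points of [S]. In
   degree 0 the weight is 0^-1 = 0. *)
pose S w : ser R n := fun v => (size v)%:R^-1 * (l - (Phi w - eul w)) v.
have LS w : is_lie w -> is_lie (S w).
  move=> hw; apply: (is_lie_weight (fun m => m%:R^-1)).
  apply: is_lieB => //; apply: is_lieB; first exact: LPhi.
  exact: (is_lie_weight (fun m => m%:R)).
have QE w v : w [::] = 0 -> (Phi w - eul w) v =
    opser size (fun k => expc k.+2) (ad w) (ad w (eul w)) v.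
  move=> w0; rewrite addfE oppfE /Phi.
  rewrite (opser_shift _ _ _ (lin_ad w) (raising_ad w0)).
  by rewrite {1}/expc invr1 mul1r addrC addKr.
have CS N w w' : is_lie w -> is_lie w' -> slo N w w' -> slo N.+1 (S w) (S w').
  move=> /is_lie_nil w0 /is_lie_nil w0' h v hv; rewrite /S !(addfE l) !(oppfE (_ - _)) !QE //.
  congr (_ * (_ - _)); apply: eq_bigr => k _; congr (_ * _); rewrite -!iterSr.
  have ad_nil f g : f [::] = 0 -> ad f g [::] = 0.
    by move=> f0; rewrite /ad addfE oppfE !mul_nil f0 mulr0 mul0r subrr.
  have en f : eul f [::] = 0 by rewrite /eul mul0r.
  suff /(_ k) : forall k, slo N.+1 (iter k.+1 (ad w) (eul w)) (iter k.+1 (ad w') (eul w')).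
    exact.
  elim=> [|m IH].
    by apply: slo_ad => // u hu; rewrite /eul h.
  apply: slo_ad => //; try exact: ad_nil.
  exact: (eqlo_le (leqnSn N)).
pose W m : ser R n := iter m S 0.
have LW m : is_lie (W m) by elim: m => [|m IH]; [exact: is_lie0|exact: LS].
have WW m k : slo m (W m) (W (m + k)%N).
  by elim: m => // m IH; rewrite addSn; apply: CS.
(* The coefficient at [v] no longer changes after [size v + 1] iterations. *)
pose w : ser R n := fun v => W (size v).+1 v.
have wW N : slo N w (W N).
  by move=> v hv; rewrite /w (WW (size v).+1 (N - (size v).+1)%N) // subnKC.
have Lw : is_lie w by apply: is_lie_lim => N; exists (W N).
exists w; split=> //; apply: funext => v.
have Sw : S w = w.
  apply: (@eqlo_all _ _ size) => -[|N] // u hu.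
  by rewrite (CS N w (W N)) // (wW N.+1).
rewrite -/(Phi w).
(* The fixed-point equation is empty in degree 0, where both sides vanish because they are Lie. *)
case: v => [|k v]; first by rewrite (is_lie_nil Ll) (is_lie_nil (LPhi _ Lw)).
have := congr1 (fun h : ser R n => (size (k :: v))%:R * h (k :: v)) Sw.
rewrite /S mulrA mulfV ?(natS_neq0 char0) // mul1r !addfE oppfE addfE oppfE => E.
move: E; rewrite -[_%:R * _]/(eul w (k :: v)) => E.
by apply/esym; move/eqP: E; rewrite opprB addrA subr_eq => /eqP; rewrite [RHS]addrC => /addIr.
Qed.

Theorem bch (u v : ser R n) : is_lie u -> is_lie v ->
  exists w, is_lie w /\ expo w = expo u * expo v.
Proof.
move=> Lu Lv; have u0 := is_lie_nil Lu; have v0 := is_lie_nil Lv.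
have Lad w g : is_lie w -> is_lie g -> is_lie (ad w g).
  by move=> hw hg; rewrite /ad -sbrE; apply: is_lie_sbr.
have Leul w : is_lie w -> is_lie (eul w) by exact: (is_lie_weight (fun m => m%:R)).
have Lop c w g : is_lie w -> is_lie g -> is_lie (opser size c (ad w) g : ser R n).
  move=> hw hg; apply: is_lie_opser => //; [exact: lin_ad|exact/raising_ad/is_lie_nil|].
  by move=> *; apply: Lad.
(* From E(e^u e^v) = e^u l(u) e^v + e^u e^v l(v), after l(u) is moved across e^v. *)
pose l : ser R n :=
  (opser size expc (ad v) (opser size (fun k => expc k.+1) (ad u) (eul u)) : ser R n)
   + (opser size (fun k => expc k.+1) (ad v) (eul v) : ser R n).
have Ll : is_lie l.
  by apply: is_lieD; apply: (Lop _ _ _) => //; [apply: (Lop _ _ _) => //|]; exact: Leul.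
have [w [Lw E]] := expo_lie_ode Ll; exists w; split=> //.
apply: (eul_uniq (is_lie_nil Ll)).
- by rewrite mul_nil !expo_nil mulr1.
- by rewrite eul_expo ?E // is_lie_nil.
rewrite eul_mul !eul_expo // /l mulrDr -mulrA mul_expo //.
by rewrite !mulrA.
Qed.

(** The hypothesis says that [u] is homogeneous of degree one, so [ad u] kills E(u) and the
    logarithmic derivative of the product is 0. *)
Lemma expo_inv u : eul u = u -> expo (- u) * expo u = 1.
Proof.
move=> eu; have u0 : u [::] = 0 by rewrite -eu /eul mul0r.
have nu0 : (- u) [::] = 0 by rewrite oppfE u0 oppr0.
have enu : eul (- u) = - u.
  by rewrite -[in RHS]eu; apply: funext => v; rewrite /eul !oppfE mulrN.
have opE w d c : w [::] = 0 -> ad w d = 0 -> opser size c (ad w) d = c 0%N *: d.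
  move=> w0 adwd; apply: funext => v.
  rewrite (opser_shift _ _ _ (lin_ad w) (raising_ad w0)) adwd.
  by rewrite (lin0 (opser_lin _ _ (lin_ad w))) addr0.
have e1 : expc 1 = 1 :> R by rewrite /expc invr1.
apply: (@eul_uniq _ _ 0) => //.
- by rewrite mul_nil !expo_nil mulr1.
- rewrite mulr0 eul_mul !eul_expo //.
  rewrite eu enu !opE //; try by rewrite /ad ?mulrNN subrr.
  rewrite e1 !scale1r mulrA -(mulrA _ (- u)) (@mul_expo (- u) u u0) opE.
  - by rewrite /expc invr1 scale1r !mulrN mulrA addNr.
  - by [].
  - by rewrite /ad mulrN mulNr subrr.
- by rewrite mulr0; apply: funext => -[|k v]; rewrite /eul ?mul0r // mulr0.
Qed.

End BCH.

(** * The divergence cocycle *)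

Section Divergence.
Variables (R : fieldType) (n : nat).
Hypothesis char0 : [pchar R] =i pred0.
Implicit Types (f g h : ser R n) (k l : 'I_n) (w v : seq 'I_n).
Implicit Types (al be : 'I_n -> ser R n).

Definition tder al : 'I_n -> ser R n := fun i => sbr (sgen i) (al i).
Definition dive al : ser R n := \sum_i sgen i * sdiff i (al i).

Lemma sgen_nil i : (sgen i : ser R n) [::] = 0. Proof. by []. Qed.

Lemma tderE al i : tder al i = sgen i * al i - al i * sgen i.
Proof. by []. Qed.

Lemma tder_nil al i : tder al i [::] = 0.
Proof. by rewrite tderE addfE oppfE !mul_nil sgen_nil mulr0 mul0r subrr. Qed.
Hint Resolve tder_nil : core.

Lemma sdiff_lin k c f g : sdiff k (c *: f + g) = c *: sdiff k f + sdiff k g.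
Proof. by []. Qed.
Lemma sdiffD k f g : sdiff k (f + g) = sdiff k f + sdiff k g.
Proof. by []. Qed.
Lemma sdiffN k f : sdiff k (- f) = - sdiff k f.
Proof. by []. Qed.
Lemma sdiff_sum k (I : Type) (s : seq I) (F : I -> ser R n) :
  sdiff k (\sum_(i <- s) F i) = \sum_(i <- s) sdiff k (F i).
Proof. exact: (big_morph (sdiff k) (sdiffD k)). Qed.

Lemma sdiff_mul k f g : sdiff k (f * g) = f * sdiff k g + g [::] *: sdiff k f.
Proof.
by apply: funext => w; rewrite addfE scalefE /sdiff -smulE smul_rcons mulrC [X in _ + X = _]mulrC mulrC.
Qed.

Lemma sdiff_mul_sgen k j f : sdiff k (f * sgen j) = (k == j)%:R *: f.
Proof. by rewrite sdiff_mul sdiff_sgen -scalerAr mulr1 sgen_nil scale0r addr0. Qed.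

Lemma sdecomp_r f : f = f [::] *: 1 + \sum_k sdiff k f * sgen k.
Proof.
apply: funext => w; case/lastP: w => [|w j]; rewrite addfE sumfE scalefE.
  rewrite big1 => [|k _]; last by rewrite mul_nil sgen_nil mulr0.
  by rewrite addr0 [X in _ * X](_ : _ = 1) // mulr1.
rewrite [X in _ * X](_ : _ = 0); last by case: w.
rewrite mulr0 add0r (bigD1 j) //= big1 => [|k kj].
  by rewrite addr0 -/(sdiff j (sdiff j f * sgen j) w) sdiff_mul_sgen eqxx scale1r.
by rewrite -/(sdiff j (sdiff k f * sgen k) w) sdiff_mul_sgen eq_sym (negbTE kj) scale0r.
Qed.

Lemma sdiff_tder al k l : al k [::] = 0 ->
  sdiff l (tder al k) = sgen k * sdiff l (al k) - (l == k)%:R *: al k.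
Proof.
by move=> a0; rewrite tderE sdiffD sdiffN sdiff_mul_sgen sdiff_mul a0 scale0r addr0.
Qed.

(** With [f] split by last letters, u acts on the rest or on the last letter x_k. In [x_k, a_k] the
    new last letter comes from a_k or is the final x_k of - a_k x_k. *)
Lemma sdiff_der al l f : (forall i, al i [::] = 0) ->
  sdiff l (der_act (tder al) f) = der_act (tder al) (sdiff l f)
   + \sum_k sdiff k f * sgen k * sdiff l (al k) - sdiff l f * al l.
Proof.
move=> a0; rewrite {1}[f]sdecomp_r der_linr der1 // scaler0 add0r.
rewrite (big_morph _ (derD _) (der0 _)) sdiff_sum.
have E k : sdiff l (der_act (tder al) (sdiff k f * sgen k)) =
    (l == k)%:R *: der_act (tder al) (sdiff k f)
    + (sdiff k f * sgen k * sdiff l (al k) - (l == k)%:R *: (sdiff k f * al k)).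
  rewrite der_mul // sdiffD sdiff_mul_sgen der_sgen //; congr (_ + _).
  rewrite sdiff_mul tder_nil scale0r addr0 sdiff_tder // mulrBr mulrA.
  by rewrite scalerAr.
under eq_bigr => k _ do rewrite E.
have S1 (F : 'I_n -> ser R n) : \sum_k (l == k)%:R *: F k = F l.
  rewrite (bigD1 l) //= eqxx scale1r big1 ?addr0 // => k kl.
  by rewrite eq_sym (negbTE kl) scale0r.
by rewrite big_split sumrB /= !S1 addrA.
Qed.

(** Components of the commutator of two tangential derivations; the term [a_i, b_i] arises by Jacobi
    from the action of each on x_i itself. *)
Definition tbr al be : 'I_n -> ser R n := fun i =>
  der_act (tder al) (be i) - der_act (tder be) (al i) + sbr (al i) (be i).

Lemma tbrE al be i : (forall i, al i [::] = 0) -> (forall i, be i [::] = 0) ->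
  tder (tbr al be) i =
  der_act (tder al) (tder be i) - der_act (tder be) (tder al i).
Proof.
move=> a0 b0; rewrite !tderE /tbr !sbrE !derB !der_mul // !der_sgen // !tderE.
rewrite !(mulrBr, mulrBl, mulrDr, mulrDl, mulrA).
by apply: funext => w; rewrite !(addfE, oppfE); ring.
Qed.

(** The part of the divergence of the bracket in which both components are differentiated.
    Exchanging [al] with [be] and [l] with [k] is a cyclic rotation, so these terms cancel in the
    trace. *)
Definition cross al be l k := tau (sgen l * sdiff k (be l) * (sgen k * sdiff l (al k))).

Lemma tau_div_der al be l : (forall i, al i [::] = 0) ->
  tau (sgen l * sdiff l (der_act (tder al) (be l))) =
  tau (der_act (tder al) (sgen l * sdiff l (be l)))
  + \sum_k cross al be l k - tau (sgen l * al l * sdiff l (be l)).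
Proof.
move=> a0; rewrite sdiff_der // der_mul // der_sgen // tderE.
rewrite mulrBr mulrDr mulrBl !(tauD, tauN) mulr_sumr tau_sum.
rewrite -[al l * sgen l * _]mulrA [tau (al l * _)]tau_mulC mulrA.
have -> : \sum_k tau (sgen l * (sdiff k (be l) * sgen k * sdiff l (al k))) =
    \sum_k cross al be l k.
  by apply: eq_bigr => k _; rewrite /cross !mulrA.
by apply: funext => w; rewrite !(addfE, oppfE); ring.
Qed.

Lemma dive_tbr al be : (forall i, al i [::] = 0) -> (forall i, be i [::] = 0) ->
  tau (dive (tbr al be)) =
  tau (der_act (tder al) (dive be) - der_act (tder be) (dive al)).
Proof.
move=> a0 b0; rewrite /dive tauB !(big_morph _ (derD _) (der0 _)) !tau_sum.
have E i : tau (sgen i * sdiff i (tbr al be i)) =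
    (tau (der_act (tder al) (sgen i * sdiff i (be i))) -
     tau (der_act (tder be) (sgen i * sdiff i (al i)))) +
    (\sum_k cross al be i k - \sum_k cross be al i k).
  (* The derivatives of [a_i, b_i] cancel the last terms of [tau_div_der]. *)
  rewrite /tbr sbrE !(sdiffD, sdiffN) !sdiff_mul a0 b0 !scale0r !addr0.
  rewrite !(mulrDr, mulrN) !(tauD, tauN) !tau_div_der // !mulrA.
  by apply: funext => w; rewrite !(addfE, oppfE); ring.
under eq_bigr => i _ do rewrite E.
rewrite big_split !sumrB /= [X in _ + (_ - X)]exchange_big /=.
have -> : \sum_j \sum_i cross be al i j = \sum_i \sum_k cross al be i k.
  by apply: eq_bigr => i _; apply: eq_bigr => k _; rewrite /cross tau_mulC.
by rewrite subrr addr0.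
Qed.

End Divergence.

(** * Affine operators *)

Section Rho.
Variables (R : fieldType) (n : nat) (T : Type) (sz : T -> nat).
Variable P : 'I_n -> (T -> R) -> (T -> R).
Hypothesis Plin : forall i, lin (P i).
Hypothesis Praise : forall i, raising sz (P i).
Implicit Types (f g : ser R n) (phi psi : T -> R) (v : T).

(** A series has no structural recursion, so fuel counts the letters read; by causality of the
    [P k], fuel [sz v] is enough at [v]. *)
Fixpoint rhoN N f phi : T -> R := fun v =>
  f [::] * phi v + if N is N'.+1 then \sum_k P k (rhoN N' (dl k f) phi) v else 0.

(* The continuous algebra morphism from series to operators with x_i |-> P i. *)
Definition rho f phi : T -> R := fun v => rhoN (sz v) f phi v.

Lemma P_small k phi v : sz v = 0%N -> P k phi v = 0.
Proof.
move=> hv; have : eqlo sz 0 phi (fun=> 0) by [].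
by move/(Praise k) => ->; rewrite ?hv // (lin0 (Plin k)).
Qed.

Lemma rhoN_agree N M f phi : (N <= M)%N ->
  eqlo sz N.+1 (rhoN N f phi) (rhoN M f phi).
Proof.
elim: N M f => [|N IH] [|M] f // NM v hv.
  rewrite /= big1 ?addr0 // => k _; apply: P_small; by case: (sz v) hv.
by rewrite /=; congr (_ + _); apply: eq_bigr => k _; apply: (Praise k (IH M _ NM)).
Qed.

Lemma rho_rec f phi v :
  rho f phi v = f [::] * phi v + \sum_k P k (rho (dl k f) phi) v.
Proof.
rewrite /rho; case E : (sz v) => [|N] /=.
  by rewrite big1 ?addr0 // => k _; apply: P_small.
congr (_ + _); apply: eq_bigr => k _; apply: (Praise k (N := N.+1)); last by rewrite E.
by move=> u hu; rewrite /rho -(@rhoN_agree (sz u) N).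
Qed.

Lemma rho_eqlo_ser N f g phi : slo N f g -> eqlo sz N (rho f phi) (rho g phi).
Proof.
elim: N f g => // N IH f g h v hv; rewrite !rho_rec (h [::]) //; congr (_ + _).
by apply: eq_bigr => k _; apply: (Praise k _ hv); apply: IH; apply: eqlo_dl.
Qed.

Lemma rho_linr c f g phi :
  rho (c *: f + g) phi = (fun v => c * rho f phi v + rho g phi v).
Proof.
apply: (@eqlo_all _ _ sz) => N; elim: N f g => // N IH f g v hv.
rewrite !rho_rec addfE scalefE.
have -> : \sum_k P k (rho (dl k (c *: f + g)) phi) v =
    c * (\sum_k P k (rho (dl k f) phi) v) + \sum_k P k (rho (dl k g) phi) v.
  rewrite mulr_sumr -big_split; apply: eq_bigr => k _ /=.
  by rewrite (Praise k (IH (dl k f) (dl k g)) hv) Plin.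
by ring.
Qed.

Lemma rho0 phi : rho 0 phi = (fun=> 0).
Proof.
have := rho_linr (-1) 0 0 phi; rewrite scaler0 addr0 => ->.
by apply: funext => v; rewrite mulN1r addNr.
Qed.

Lemma rho_sum (I : Type) (s : seq I) (c : I -> R) (F : I -> ser R n) phi v :
  rho (\sum_(i <- s) c i *: F i) phi v = \sum_(i <- s) c i * rho (F i) phi v.
Proof.
elim: s => [|i s IH]; first by rewrite !big_nil rho0.
by rewrite !big_cons rho_linr IH.
Qed.

Lemma rho_mul f g phi : rho (f * g) phi = rho f (rho g phi).
Proof.
apply: (@eqlo_all _ _ sz) => N; elim: N f g => // N IH f g v hv.
rewrite rho_rec [RHS]rho_rec [rho g phi v]rho_rec mul_nil.
have -> : \sum_k P k (rho (dl k (f * g)) phi) v =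
    f [::] * (\sum_k P k (rho (dl k g) phi) v) + \sum_k P k (rho (dl k f) (rho g phi)) v.
  rewrite mulr_sumr -big_split; apply: eq_bigr => k _ /=.
  rewrite dl_mul rho_linr Plin; congr (_ + _).
  by apply: (Praise k (IH (dl k f) g)).
by ring.
Qed.

Lemma rho1 phi : rho 1 phi = phi.
Proof.
apply: funext => v; rewrite rho_rec [(1 : ser R n) [::]](_ : _ = 1) // mul1r.
rewrite big1 ?addr0 // => k _; rewrite dl1.
by rewrite rho0 lin0.
Qed.

Lemma rho_gen i phi : rho (sgen i) phi = P i phi.
Proof.
apply: funext => v; rewrite rho_rec [sgen i [::]](_ : _ = 0) // mul0r add0r.
have E k : rho (dl k (sgen i)) phi = (fun v => (k == i)%:R * phi v).
  have := rho_linr (k == i)%:R 1 0 phi; rewrite rho1 rho0 addr0 -dl_sgen => ->.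
  by apply: funext => u; rewrite addr0.
under eq_bigr => k _ do rewrite E linZ //.
rewrite (bigD1 i) //= eqxx mul1r big1 ?addr0 // => k ki.
by rewrite (negbTE ki) mul0r.
Qed.

Lemma rho_opp f phi : rho (- f) phi = (fun v => - rho f phi v).
Proof.
have := rho_linr (-1) f 0 phi; rewrite addr0 scaleN1r rho0 => ->.
by apply: funext => v; rewrite addr0 mulN1r.
Qed.

Lemma rho_sbr f g phi :
  rho (sbr f g) phi = (fun v => rho f (rho g phi) v - rho g (rho f phi) v).
Proof.
have := rho_linr (-1) (g * f) (f * g) phi; rewrite scaleN1r addrC sbrE => ->.
by rewrite !rho_mul; apply: funext => v; rewrite mulN1r addrC.
Qed.

Lemma rho_exp f m phi : rho (f ^+ m) phi = iter m (rho f) phi.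
Proof.
by elim: m => [|m IH]; rewrite ?expr0 ?rho1 // exprS rho_mul IH.
Qed.

Lemma rho_expo f phi : f [::] = 0 -> rho (expo f) phi = opser sz expc (rho f) phi.
Proof.
move=> f0; apply: funext => v.
have E : slo (sz v).+1 (expo f) (\sum_(m < (sz v).+1) expc m *: f ^+ m).
  by move=> u hu; apply: ps_eval_trunc.
rewrite (rho_eqlo_ser phi E (ltnSn _)) rho_sum; apply: eq_bigr => m _.
by rewrite rho_exp.
Qed.

End Rho.

(** * Tangential derivations paired with a divergence *)

Section AffineOperators.
Variables (R : fieldType) (n : nat).
Hypothesis char0 : [pchar R] =i pred0.
Implicit Types (f g h : ser R n) (i : 'I_n) (w v u : seq 'I_n).

(** Finite functions and a product, to inherit the module structure for linear combinations. *)
Definition tri : Type := ({ffun 'I_n -> ser R n} * ser R n)%type.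
Implicit Types (t : tri) (phi psi : option (seq 'I_n) -> R).

Definition osz (o : option (seq 'I_n)) : nat := if o is Some w then size w else 0.

(* phi encodes a pair (f, r) of a series f and a scalar r, stored at None; the
   operator of t = (al, d) is (f, r) |-> (u f + r d, 0) with u(x_i) = [x_i, al i]. *)
Definition ops t phi : option (seq 'I_n) -> R := fun o =>
  if o is Some w then der_act (tder t.1) (fun u => phi (Some u)) w + phi None * t.2 w
  else 0.

(** The second component is pinned down only in tr, since the cocycle identity [dive_tbr] that keeps
    the condition stable under brackets holds only there. *)
Definition good t := [/\ forall i, is_lie (t.1 i), forall i, t.1 i [:: i] = 0 &
  tau t.2 = tau (dive t.1)].

Definition tbr3 t t' : tri :=
  ([ffun i => tbr t.1 t'.1 i],
   der_act (tder t.1) t'.2 - der_act (tder t'.1) t.2).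

Lemma good_nil1 t i : good t -> t.1 i [::] = 0.
Proof. by case=> h _ _; apply: is_lie_nil. Qed.

Lemma good_nil2 t : good t -> t.2 [::] = 0.
Proof.
case=> _ _ /(congr1 (fun h : ser R n => h [::])) /= ->.
by rewrite /dive sumfE big1 // => i _; rewrite mul_nil sgen_nil mul0r.
Qed.

Lemma tder_small (al : 'I_n -> ser R n) : (forall i, al i [::] = 0) ->
  forall i v, (size v < 2)%N -> tder al i v = 0.
Proof.
move=> a0 i v hv; rewrite tderE addfE oppfE.
have H : slo 1 (al i) (0 : ser R n) by case=> //.
rewrite (raising_mull (@sgen_nil R n i) H hv) (raising_mulr (@sgen_nil R n i) H hv).
by rewrite mulr0 mul0r subr0.
Qed.

Lemma ops_lin t : lin (ops t).
Proof.
move=> c phi psi; apply: funext => -[w|] /=; last by rewrite mulr0 addr0.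
rewrite -/(ser R n) [der_act _ _](_ : _ =
  c *: der_act (tder t.1) (fun u => phi (Some u)) + der_act (tder t.1) (fun u => psi (Some u))).
  by rewrite addfE scalefE; ring.
exact: der_lin.
Qed.

Lemma ops_raising t : good t -> raising osz (ops t).
Proof.
move=> gt; have a0 i := good_nil1 i gt; have d0 := good_nil2 gt.
case=> [|N] phi psi h [w|] //= hw.
  by case: w hw => // _; rewrite !der_nil ?d0 ?mulr0 //; exact: tder_nil.
rewrite (h None) //; congr (_ + _).
by apply: (der_raising (tder_small a0) _ hw) => u hu; apply: h.
Qed.

Lemma ops_tbr t t' phi : good t -> good t' ->
  ops (tbr3 t t') phi = (fun o => ops t (ops t' phi) o - ops t' (ops t phi) o).
Proof.
move=> gt gt'; have a0 i := good_nil1 i gt; have a0' i := good_nil1 i gt'.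
apply: funext => -[w|] /=; last by rewrite subr0.
set f : ser R n := fun u => phi (Some u); set r := phi None.
have E s : (fun u => ops s phi (Some u)) = r *: s.2 + der_act (tder s.1) f :> ser R n.
  by apply: funext => u; rewrite /ops addrC.
have -> : (fun u => der_act (tder t'.1) f u + r * t'.2 u) = r *: t'.2 + der_act (tder t'.1) f :> ser R n.
  exact: E.
have -> : (fun u => der_act (tder t.1) f u + r * t.2 u) = r *: t.2 + der_act (tder t.1) f :> ser R n.
  exact: E.
rewrite !der_linr !mul0r !addr0.
have -> : tder [ffun i => tbr t.1 t'.1 i] =
    (fun i => der_act (tder t.1) (tder t'.1 i) - der_act (tder t'.1) (tder t.1 i)).
  by apply: funext => i; rewrite -tbrE // !tderE ffunE.
rewrite -der_comm; try exact: tder_nil.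
rewrite !(addfE, oppfE, scalefE); ring.
Qed.

Lemma ops_linr c t t' phi :
  ops (c *: t + t') phi = (fun o => c * ops t phi o + ops t' phi o).
Proof.
apply: funext => -[w|] /=; last by rewrite mulr0 addr0.
have -> : tder (c *: t + t').1 = (fun i => c *: tder t.1 i + tder t'.1 i).
  apply: funext => i; rewrite !tderE !ffunE mulrDr mulrDl -scalerAr -scalerAl.
  by rewrite scalerBr opprD addrACA.
rewrite der_linD; try exact: tder_nil.
rewrite !(addfE, scalefE); ring.
Qed.

Lemma ops0 phi : ops 0 phi = (fun=> 0).
Proof.
have := ops_linr (-1) 0 0 phi; rewrite scaler0 addr0 => ->.
by apply: funext => v; rewrite mulN1r addNr.
Qed.

Lemma ops_sum (I : Type) (s : seq I) (c : I -> R) (F : I -> tri) phi o :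
  ops (\sum_(j <- s) c j *: F j) phi o = \sum_(j <- s) c j * ops (F j) phi o.
Proof.
elim: s => [|j s IH]; first by rewrite !big_nil ops0.
by rewrite !big_cons ops_linr IH.
Qed.

Definition tri_eqlo N t t' := (forall i, slo N (t.1 i) (t'.1 i)) /\ slo N t.2 t'.2.

Lemma der_eqlo_gen N (D D' : 'I_n -> ser R n) f :
  (forall i, D i [::] = 0) -> (forall i, D' i [::] = 0) ->
  (forall i, slo N (D i) (D' i)) -> slo N (der_act D f) (der_act D' f).
Proof.
move=> D0 D0' h v; elim: v f => [|j w IH] f hv; first by rewrite !der_nil.
rewrite (der_cons _ _ _ D0) (der_cons _ _ _ D0') (IH (dl j f) (ltnW hv)); congr (_ + _).
by rewrite !sumfE; apply: eq_bigr => k _; apply: (slo_mul (h k) (fun _ _ => erefl)).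
Qed.

Lemma tder_eqlo N (al be : 'I_n -> ser R n) i :
  slo N (al i) (be i) -> slo N.+1 (tder al i) (tder be i).
Proof.
move=> h v hv; rewrite !tderE !addfE !oppfE.
by rewrite (raising_mull (@sgen_nil R n i) h hv) (raising_mulr (@sgen_nil R n i) h hv).
Qed.

Lemma ops_eqlo N t t' phi : tri_eqlo N t t' -> eqlo osz N (ops t phi) (ops t' phi).
Proof.
move=> [h1 h2] [w|] //= hw; rewrite h2 //; congr (_ + _).
apply: (der_eqlo_gen _ _ _ _ hw); try exact: tder_nil.
by move=> i; apply: eqlo_le (leqnSn _) _; apply: tder_eqlo.
Qed.

Lemma dive_lin c (al be : 'I_n -> ser R n) :
  dive (fun i => c *: al i + be i) = c *: dive al + dive be.
Proof.
rewrite /dive scaler_sumr -big_split; apply: eq_bigr => i _ /=.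
by rewrite sdiff_lin mulrDr -scalerAr.
Qed.

Lemma dive_eqlo N (al be : 'I_n -> ser R n) : (forall i, slo N (al i) (be i)) ->
  slo N (dive al) (dive be).
Proof.
case: N => [|N] h //; apply: eqlo_sum => i; apply: raising_mull => // v hv.
by apply: h; rewrite size_rcons.
Qed.

Lemma good_lin c t t' : good t -> good t' -> good (c *: t + t').
Proof.
move=> [L Z E] [L' Z' E']; have F i : (c *: t + t').1 i = c *: t.1 i + t'.1 i.
  by rewrite !ffunE.
split=> [i|i|]; rewrite ?F; first exact: is_lie_lin.
  by rewrite addfE scalefE Z Z' mulr0 addr0.
rewrite [(_ + _).2]/(c *: t.2 + t'.2) tau_lin E E' -tau_lin -dive_lin.
by congr (tau (dive _)); apply: funext => i; rewrite F.
Qed.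

Lemma good0 : good 0.
Proof.
split=> [i|i|]; rewrite ?ffunE //; first exact: is_lie0.
congr tau; rewrite /dive big1 // => i _; rewrite ffunE.
by rewrite [sdiff _ _](_ : _ = 0) // mulr0.
Qed.

Lemma good_sum (I : Type) (s : seq I) (F : I -> tri) (c : I -> R) :
  (forall j, good (F j)) -> good (\sum_(j <- s) c j *: F j).
Proof.
by move=> h; elim/big_rec: _ => [|j x _ hx]; [apply: good0|apply: good_lin].
Qed.

Lemma good_tbr t t' : good t -> good t' -> good (tbr3 t t').
Proof.
move=> gt gt'; have a0 i := good_nil1 i gt; have a0' i := good_nil1 i gt'.
case: (gt) => L Z E; case: (gt') => L' Z' E'.
have Ltd s i : good s -> is_lie (tder s.1 i).
  by case=> Ls _ _; apply: is_lie_sbr => //; apply: is_lie_sgen.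
have LE i : is_lie (tbr t.1 t'.1 i).
  rewrite /tbr; apply: is_lieD; last exact: is_lie_sbr.
  by apply: is_lieB; apply: is_lie_der => //; try exact: tder_nil; move=> j; apply: Ltd.
split=> [i|i|] /=; rewrite ?ffunE //.
  (* A bracket starts in degree two, so it stays normalized. *)
  have S s f : good s -> slo 2 (der_act (tder s.1) f) (0 : ser R n).
    move=> gs v hv; have H : slo 0 f (0 : ser R n) by [].
    have r := der_raising (tder_small (fun i => good_nil1 i gs)).
    case: v hv => [|j [|? ?]] // _; first by rewrite der_nil //; exact: tder_nil.
    rewrite der_cons ?der_nil; try exact: tder_nil.
    rewrite addr0 sumfE big1 // => k _.
    rewrite mul_cons tder_nil mul0r add0r mul_nil /dl tder_small ?mul0r //.
    by move=> ?; apply: good_nil1.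
  rewrite /tbr sbrE !addfE !oppfE !S // !mul_cons !mul_nil a0 a0'.
  by rewrite !zerofE !mul0r !mulr0 !addr0 !subrr addr0.
transitivity (tau (dive (tbr t.1 t'.1))); last first.
  by congr (tau (dive _)); apply: funext => i; rewrite ffunE.
rewrite dive_tbr // !tauB; congr (_ - _); apply/eqP; rewrite -subr_eq0 -tauB -derB;
  apply/eqP; apply: (tau_der char0); try exact: tder_nil; by rewrite tauB ?E ?E' subrr.
Qed.

Lemma good_lim t : (forall N, exists t', good t' /\ tri_eqlo N t t') -> good t.
Proof.
move=> h; split=> [i|i|].
- apply: is_lie_lim => N; case: (h N) => t' [[L _ _] [E _]].
  by exists (t'.1 i).
- by case: (h 2%N) => t' [[_ Z _] [E _]]; rewrite E.
apply: (@eqlo_all _ _ size) => N; case: (h N) => t' [[_ _ T] [E1 E2]] v hv.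
by rewrite (tau_eqlo E2 hv) T -(tau_eqlo (dive_eqlo E1) hv).
Qed.

Section Lift.
Variables (m : nat) (ts : 'I_m -> tri).
Hypothesis gts : forall j, good (ts j).

(** Mirrors [lbr] with pairs for letters, to follow which pair represents the operator of a nested
    bracket. *)
Fixpoint tlbr (w : seq 'I_m) : tri :=
  match w with
  | [::] => 0
  | [:: j] => ts j
  | j :: w' => tbr3 (ts j) (tlbr w')
  end.

Notation rh := (rho osz (fun j => ops (ts j))).

Lemma good_tlbr (w : seq 'I_m) : good (tlbr w).
Proof.
elim: w => [|j [|k w] IH]; [exact: good0|exact: gts|].
exact: (good_tbr (gts j) IH).
Qed.

Lemma rho_lbr (w : seq 'I_m) phi : rh (lbr w : ser R m) phi = ops (tlbr w) phi.
Proof.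
have Pl j : lin (ops (ts j)) by exact: ops_lin.
have Pr j : raising osz (ops (ts j)) by exact: ops_raising.
elim: w phi => [|j [|k w] IH] phi.
- by rewrite [lbr _](_ : _ = 0) // rho0 // ops0.
- exact: rho_gen.
rewrite [tlbr _]/(tbr3 (ts j) (tlbr (k :: w))) (ops_tbr _ (gts j) (good_tlbr _)).
rewrite [lbr _]/(sbr (sgen j) (lbr (k :: w))) rho_sbr //.
by rewrite !rho_gen // !IH.
Qed.

(** Each bracketing gains one degree, so infinite sums of nested brackets converge in both
    components. *)
Lemma tlbr_small (w : seq 'I_m) : tri_eqlo (size w) (tlbr w) 0.
Proof.
elim: w => [|j [|k w] IH]; first by split.
  split=> [i|] [|? ?] //= _; rewrite ?ffunE.
    by rewrite (good_nil1 i (gts j)).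
  by rewrite (good_nil2 (gts j)).
have gw := good_tlbr (k :: w); have gj := gts j.
rewrite [tlbr _]/(tbr3 (ts j) (tlbr (k :: w))).
set t' := tlbr (k :: w) in IH gw *; set t := ts j in gj *.
change (tri_eqlo (size (k :: w)).+1 (tbr3 t t') 0); move: (size (k :: w)) IH => N [IH1 IH2].
have D1 f : slo N f (0 : ser R n) -> slo N.+1 (der_act (tder t.1) f) (0 : ser R n).
  move=> h v hv; rewrite (der_raising (tder_small (fun i => good_nil1 i gj)) h hv).
  by rewrite der0.
have D2 f : slo N.+1 (der_act (tder t'.1) f) (0 : ser R n).
  pose z (i : 'I_n) : ser R n := 0.
  have zE : der_act (tder z) f = 0.
    rewrite -(@der_uniq _ _ (tder z) (fun=> 0) f) //; first exact: tder_nil.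
    - by move=> c g h; rewrite scaler0 addr0.
    - by move=> g h; rewrite mul0r mulr0 addr0.
    - by move=> i; rewrite tderE mulr0 mul0r subr0.
  have hz i : slo N.+1 (tder t'.1 i) (tder z i).
    by apply: tder_eqlo => u hu; rewrite (IH1 i u hu) ffunE.
  by have := der_eqlo_gen f (tder_nil t'.1) (tder_nil z) hz; rewrite zE.
split=> [i|] v hv; rewrite ?ffunE /=.
  have h0 : slo N (t'.1 i) (0 : ser R n) by move=> u hu; rewrite (IH1 i u hu) ffunE.
  rewrite /tbr sbrE !addfE !oppfE (D1 _ h0) // D2 //.
  rewrite (raising_mull (good_nil1 i gj) h0) // (raising_mulr (good_nil1 i gj) h0) //.
  by rewrite mulr0 mul0r !zerofE subrr !addr0.
by rewrite addfE oppfE (D1 _ IH2) // D2 // subr0.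
Qed.

(** Holds for nested brackets by [rho_lbr]; the general case is a limit, under which [good] is
    stable. Coefficients are chosen in each degree, and the limit is read diagonally. *)
Lemma rho_lie (w : ser R m) : is_lie w ->
  exists t, good t /\ forall phi, rh w phi = ops t phi.
Proof.
move=> Lw; pose c d : d.-tuple 'I_m -> R := sval (cid (Lw d)).
have cE d : shom d w =1 (fun v : seq _ => \sum_(s : d.-tuple 'I_m) c d s * lbr s v).
  exact: svalP (cid (Lw d)).
pose W N : ser R m := \sum_(d < N) \sum_(s : d.-tuple 'I_m) c d s *: lbr s.
pose S N : tri := \sum_(d < N) \sum_(s : d.-tuple 'I_m) c d s *: tlbr s.
have gS N : good (S N).
  have -> : S N = \sum_(d < N) 1 *: \sum_(s : d.-tuple 'I_m) c d s *: tlbr s.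
    by apply: eq_bigr => d _; rewrite scale1r.
  by apply: good_sum => d; apply: good_sum => s; apply: good_tlbr.
have wW N : slo N w (W N).
  have -> : W N = \sum_(d < N) shom d w.
    apply: eq_bigr => d _; apply: funext => v; rewrite cE sumfE.
    exact: eq_bigr.
  exact: sum_shom.
have fst_sum (I : finType) (F : I -> tri) i : (\sum_j F j).1 i = \sum_j (F j).1 i.
  by rewrite (raddf_sum fst) sum_ffunE.
have snd_sum (I : finType) (F : I -> tri) : (\sum_j F j).2 = \sum_j (F j).2.
  exact: (raddf_sum snd).
have SS N k : tri_eqlo N (S (N + k)%N) (S N).
  elim: k => [|k IH]; first by rewrite addn0.
  rewrite addnS /S big_ord_recr /=.
  have Z : tri_eqlo N (\sum_(s : (N + k).-tuple 'I_m) c (N + k)%N s *: tlbr s) 0.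
    split=> [i|] v hv; rewrite ?fst_sum ?snd_sum sumfE ?ffunE big1 // => s _.
      have [h _] := tlbr_small s; rewrite size_tuple in h.
      rewrite ffunE scalefE (h i v) ?ffunE ?mulr0 //.
      by apply: leq_trans hv (leq_addr _ _).
    have [_ h] := tlbr_small s; rewrite size_tuple in h.
    rewrite -[LHS]/(c (N + k)%N s * (tlbr s).2 v) (h v) ?mulr0 //.
    by apply: leq_trans hv (leq_addr _ _).
  case: IH Z => I1 I2 [Z1 Z2]; split=> [i|] v hv.
    by rewrite ffunE addfE (I1 i v hv) (Z1 i v hv) ffunE addr0.
  by apply: etrans (congr2 +%R (I2 v hv) (Z2 v hv)) _; rewrite addr0.
pose t : tri := ([ffun i => (fun v => (S (size v).+1).1 i v) : ser R n],
                 (fun v => (S (size v).+1).2 v) : ser R n).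
have tS N : tri_eqlo N t (S N).
  split=> [i|] v hv; rewrite /t ?ffunE /=;
    have [h1 h2] := SS (size v).+1 (N - (size v).+1)%N; rewrite subnKC // in h1 h2.
    by rewrite h1.
  by rewrite h2.
exists t; split; first by apply: good_lim => N; exists (S N).
move=> phi; apply: (@eqlo_all _ _ osz) => N v hv.
rewrite (ops_eqlo phi (tS N) hv).
have Pl j : lin (ops (ts j)) by exact: ops_lin.
have Pr j : raising osz (ops (ts j)) by exact: ops_raising.
rewrite (rho_eqlo_ser Pl Pr phi (wW N) hv).
have -> : W N = \sum_(d < N) 1 *: \sum_(s : d.-tuple 'I_m) c d s *: lbr s.
  by apply: eq_bigr => d _; rewrite scale1r.
have -> : S N = \sum_(d < N) 1 *: \sum_(s : d.-tuple 'I_m) c d s *: tlbr s.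
  by apply: eq_bigr => d _; rewrite scale1r.
rewrite ops_sum rho_sum //; apply: eq_bigr => d _; congr (_ * _).
rewrite ops_sum rho_sum //; apply: eq_bigr => s _; congr (_ * _).
by rewrite rho_lbr.
Qed.

End Lift.
End AffineOperators.

(** * The second cohomology of tr *)

Lemma tau_rot (R : fieldType) n (f : ser R n) i w : tau f (rot i w) = tau f w.
Proof.
have [hi|hi] := ltnP (size w) i; first by rewrite rot_oversize 1?ltnW.
case: w hi => [|k w] hi; first by case: i hi.
case E : (rot i (k :: w)) => [|j u]; first by have := size_rot i (k :: w); rewrite E.
rewrite /tau -E size_rot.
rewrite -[RHS](@sum_rot R n f (k :: w) i hi); apply: eq_bigr => j' _; congr f.
by rewrite rot_rot.
Qed.

Lemma tau_letters (R : fieldType) n m (S : 'I_n -> ser R m) (p : pred 'I_m)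
    (q : 'I_m -> 'I_n) (f : ser R n) v :
  (forall i, S i = (fun w => if w is [:: j] then (p j && (q j == i))%:R else 0)) ->
  tau (ssubst S f) v = if all p v then tau f (map q v) else 0.
Proof.
move=> HS; have S0 i : S i [::] = 0 by rewrite HS.
case: v => [|j v]; first by rewrite /tau (ssubst_letters S0 _ _ HS).
rewrite /tau; set u := j :: v; rewrite -[map q u]/(q j :: map q v).
have -> : size (q j :: map q v) = size u by rewrite /= size_map.
transitivity (\sum_(i < size u) if all p u then f (rot i (map q u)) else 0).
  apply: eq_bigr => i _; rewrite (ssubst_letters S0 _ _ HS) map_rot.
  by rewrite (perm_all _ (permEl (perm_rot i u))).
by case: (all p u) => //; rewrite big1.
Qed.

Section TwoCocycles.
Variable (R : fieldType).
Hypothesis char0 : [pchar R] =i pred0.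
Implicit Types (g : ser R 2) (c : nat -> R).

Lemma i2P (i : 'I_2) : i = ix \/ i = iy.
Proof. by case: i => [[|[|?]] hi] //; [left|right]; apply: val_inj. Qed.

Lemma i3P (i : 'I_3) : [\/ i = i3x, i = i3y | i = i3z].
Proof.
by case: i => [[|[|[|?]]] hi] //; [constructor 1|constructor 2|constructor 3];
  apply: val_inj.
Qed.

(** Letter maps pulling words back along g(y,z), g(x+y,z) and g(x,y+z); g(x,y) uses [qx] on words
    without z. The value of [qyz] at x is a default that the guard excludes. *)
Let qyz (j : 'I_3) : 'I_2 := if j == i3y then ix else iy.
Let qz (j : 'I_3) : 'I_2 := if j == i3z then iy else ix.
Let qx (j : 'I_3) : 'I_2 := if j == i3x then ix else iy.

Lemma tau_delta2 g v : tau (delta2 g) v =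
  (if all (fun j => j != i3x) v then tau g (map qyz v) else 0) - tau g (map qz v)
  + tau g (map qx v) - (if all (fun j => j != i3z) v then tau g (map qx v) else 0).
Proof.
rewrite /delta2 !ssubE !saddE !(tauB, tauD) !(addfE, oppfE).
have H : forall i : 'I_2, forall p' q' : ser R 3, forall p q,
   (forall j, p' [:: j] = (p j && (q j == ix))%:R) -> p' [::] = 0 ->
   (forall j, q' [:: j] = (p j && (q j == iy))%:R) -> q' [::] = 0 ->
   (forall j k u, p' (j :: k :: u) = 0) -> (forall j k u, q' (j :: k :: u) = 0) ->
   subst2 p' q' i = (fun w => if w is [:: j] then (p j && (q j == i))%:R else 0).
  move=> i p' q' p q p1 p0 q1 q0 p2 q2; apply: funext => w; rewrite /subst2.
  by case: (i2P i) => ->; case: w => [|j [|k u]].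
congr (_ - _ + _ - _).
- apply: tau_letters => i; apply: H => [j||j||j k u|j k u]; rewrite ?addfE /sgen ?eqseq_cons ?andbF ?addr0 //;
    case: (i3P j) => ->; rewrite /= ?add0r ?addr0 //.
- rewrite (@tau_letters _ _ _ _ predT qz) ?all_predT // => i; apply: H => [j||j||j k u|j k u]; rewrite ?addfE /sgen ?eqseq_cons ?andbF ?addr0 //;
    case: (i3P j) => ->; rewrite /= ?add0r ?addr0 //.
- rewrite (@tau_letters _ _ _ _ predT qx) ?all_predT // => i; apply: H => [j||j||j k u|j k u]; rewrite ?addfE /sgen ?eqseq_cons ?andbF ?addr0 //;
    case: (i3P j) => ->; rewrite /= ?add0r ?addr0 //.
apply: tau_letters => i; apply: H => [j||j||j k u|j k u]; rewrite ?addfE /sgen ?eqseq_cons ?andbF ?addr0 //;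
    case: (i3P j) => ->; rewrite /= ?add0r ?addr0 //.
Qed.

Definition mixed (u : seq 'I_2) := has (pred1 ix) u && has (pred1 iy) u.

(* A cocycle has the same trace coefficient on every word containing both letters:
   mark one occurrence of X by x, and rename the other letters X, Y to y, z. *)
Lemma cocycle_mixed g u : g [::] = 0 -> tau (delta2 g) = 0 ->
  tau g u = if mixed u then tau g (ix :: nseq (size u).-1 iy) else 0.
Proof.
move=> g0 dg; have E v := tau_delta2 g v; rewrite dg in E.
rewrite /mixed; have [hx|nx] /= := boolP (has (pred1 ix) u); last first.
  have uE : u = nseq (size u) iy.
    apply/all_pred1P; apply/allP => i iu; case: (i2P i) => [|->] // ix_.
    by case/hasP: nx; exists i => //; rewrite ix_.
  case: (size u) uE => [|m] ->; first by rewrite /tau g0.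
  (* On powers of z the first two terms cancel and g(x,y) is absent, leaving the coefficient of g at
     powers of y. *)
  have := E (nseq m.+1 i3z); rewrite zerofE !map_nseq !all_nseq /= subrr add0r subr0.
  by move=> <-.
have {hx} : ix \in u by case/hasP: hx => i iu /eqP <-.
case/splitPr => u1 u2; pose r (i : 'I_2) := if i == ix then i3y else i3z.
have := E (map r u1 ++ i3x :: map r u2); rewrite zerofE !all_cat !map_cat /= andbF.
have mqz w : map qz (map r w) = w.
  by rewrite -map_comp -[RHS]map_id; apply: eq_map => i /=; case: (i2P i) => ->.
have mqx w : map qx (map r w) = nseq (size w) iy.
  by elim: w => //= i w ->; case: (i2P i) => ->.
have arz w : all (fun j => j != i3z) (map r w) = ~~ has (pred1 iy) w.
  by elim: w => //= i w ->; case: (i2P i) => ->.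
rewrite !mqz !mqx !arz has_cat /= -negb_or.
have -> : tau g (nseq (size u1) iy ++ ix :: nseq (size u2) iy) =
    tau g (ix :: nseq (size (u1 ++ ix :: u2)).-1 iy).
  rewrite -(tau_rot g (size (nseq (size u1) iy))) rot_size_cat /= -nseqD.
  by rewrite size_cat /= addnS addnC.
move=> /esym/eqP; rewrite sub0r.
(* If [u] has no letter [iy], the marked word has no z, so g(x,y) cancels g(x,y+z) and [tau g u]
   vanishes. *)
case: (has _ _ || has _ _) => /=; rewrite ?subr0 ?addrK ?oppr_eq0.
  by rewrite addrC subr_eq0 => /eqP.
by move/eqP.
Qed.

Definition delta1 c : ser R 2 := ps_eval c sx - ps_eval c (sx + sy) + ps_eval c sy.

Lemma ps_eval_letters c (p : pred 'I_2) (S : ser R 2) w :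
  (forall w, S w = if w is [:: j] then (p j)%:R else 0) ->
  ps_eval c S w = c (size w) * (all p w)%:R.
Proof.
move=> HS; have pE m : forall w, (S ^+ m) w = ((size w == m) && all p w)%:R.
  elim: m => [|m IH] [|j {}w] //=; first by rewrite exprS mul_nil HS mul0r.
  rewrite exprS mul_cons HS mul0r add0r.
  have -> : dl j S = (p j)%:R *: 1.
    apply: funext => u; rewrite /dl HS scalefE; case: u => [|? ?].
      by rewrite [X in _ * X](_ : _ = 1) // mulr1.
    by rewrite [X in _ * X](_ : _ = 0) // mulr0.
  by rewrite -scalerAl mul1r scalefE IH -natrM mulnb andbCA.
rewrite (@ps_eval_trunc _ _ c S (size w)) ?HS // sumfE big_ord_recr /=.
rewrite scalefE pE eqxx /= big1 ?add0r // => i _.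
by rewrite scalefE pE gtn_eqF ?mulr0.
Qed.

Lemma delta1E c w : c 0%N = 0 -> delta1 c w = - c (size w) * (mixed w)%:R.
Proof.
move=> c0; rewrite /delta1 !addfE oppfE.
rewrite (@ps_eval_letters c (pred1 ix)); last first.
  by move=> [|i [|? ?]] //; rewrite /sx /sgen eqseq_cons /= ?andbT ?andbF //; case: eqP.
rewrite (@ps_eval_letters c predT); last first.
  move=> [|i [|? ?]]; rewrite addfE /sx /sy /sgen ?eqseq_cons /= ?andbF ?addr0 //.
  by case: (i2P i) => ->; rewrite /= ?add0r ?addr0.
rewrite (@ps_eval_letters c (pred1 iy)); last first.
  by move=> [|i [|? ?]] //; rewrite /sy /sgen eqseq_cons /= ?andbT ?andbF //; case: eqP.
case: w => [|i w]; first by rewrite c0 !mul0r oppr0 mul0r !addr0.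
rewrite all_predT /mixed.
have ax u : all (pred1 ix) u = ~~ has (pred1 iy) u.
  by elim: u => //= j u ->; case: (i2P j) => ->.
have ay u : all (pred1 iy) u = ~~ has (pred1 ix) u.
  by elim: u => //= j u ->; case: (i2P j) => ->.
rewrite ax ay; have : has (pred1 ix) (i :: w) || has (pred1 iy) (i :: w).
  by rewrite /=; case: (i2P i) => ->; rewrite /= ?orbT.
by case: (has _ _); case: (has _ _) => //= _; ring.
Qed.

Lemma mixed_rot i u : mixed (rot i u) = mixed u.
Proof. by rewrite /mixed !(perm_has _ (permEl (perm_rot i u))). Qed.

Lemma tau_delta1 c w : c 0%N = 0 ->
  tau (delta1 c) w = - (c (size w) *+ size w) * (mixed w)%:R.
Proof.
move=> c0; case: w => [|i w]; first by rewrite /tau delta1E // mulr0n oppr0 mul0r c0 oppr0 mul0r.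
rewrite /tau; set u := i :: w.
under eq_bigr => j _ do rewrite delta1E // size_rot mixed_rot.
by rewrite sumr_const card_ord -mulrnAl mulNrn.
Qed.

Theorem cocycle_coboundary g : g [::] = 0 -> tau (delta2 g) = 0 ->
  exists c, c 0%N = 0 /\ tau g = tau (delta1 c).
Proof.
move=> g0 dg.
(* [tau (delta1 c)] equals - m c_m on mixed words of length m. *)
pose c m := - ((m%:R : R)^-1 * tau g (ix :: nseq m.-1 iy)).
have c0 : c 0%N = 0 by rewrite /c invr0 mul0r oppr0.
exists c; split=> //; apply: funext => u.
rewrite tau_delta1 // (cocycle_mixed _ g0 dg).
case: u => [|i u]; first by rewrite mulr0.
case: (mixed _); rewrite ?mulr0 // mulr1 /c mulNrn opprK -mulrnAl.
by rewrite -mulr_natr mulVf ?mul1r // natS_neq0.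
Qed.

(** The coefficients of [delta1 c] depend only on the length and on the letters present, so the
    eight sets of letters in {x, y, z} are checked. *)
Lemma coboundary_cocycle g c : c 0%N = 0 -> tau g = tau (delta1 c) ->
  tau (delta2 g) = 0.
Proof.
move=> c0 E; apply: funext => v; rewrite tau_delta2 E !tau_delta1 // !size_map.
have H (a : pred 'I_3) : has a v = [|| a i3x && has (pred1 i3x) v,
    a i3y && has (pred1 i3y) v | a i3z && has (pred1 i3z) v].
  elim: v => [|j v IH] /=; first by rewrite !andbF.
  by rewrite IH; case: (i3P j) => -> /=; case: (a _); case: (a _); case: (a _);
    rewrite /= ?orbT ?orbF.
have A (a : pred 'I_3) : all a v = ~~ has (predC a) v by rewrite has_predC negbK.
move: (has (pred1 i3x) v) (has (pred1 i3y) v) (has (pred1 i3z) v) H => hx hy hz H.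
rewrite /mixed !has_map !A !H /= zerofE.
by case: hx {H}; case: hy; case: hz => /=; ring.
Qed.

End TwoCocycles.

(** * Tangential automorphisms *)

Section Exponential.
Variables (R : fieldType) (n : nat).
Hypothesis char0 : [pchar R] =i pred0.
Implicit Types (f g h z : ser R n) (t : tri R n) (c : nat -> R).

Definition tact t : ser R n -> ser R n := der_act (tder t.1).
Definition texp t f : ser R n := opser size expc (tact t) f.
Definition tj t : ser R n := opser size (fun k => expc k.+1) (tact t) t.2.

Lemma tact_raising t : good t -> sraising (tact t).
Proof. by move=> gt; apply: der_raising; apply: tder_small => i; apply: good_nil1. Qed.

Lemma tact_lin t : lin (tact t).
Proof. exact: der_lin. Qed.

Lemma tact_mul t f g : tact t (f * g) = tact t f * g + f * tact t g.
Proof. by apply: der_mul => i; apply: tder_nil. Qed.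

Lemma tau_tact t f : tau f = 0 -> tau (tact t f) = 0.
Proof. by apply: (tau_der char0) => i; apply: tder_nil. Qed.

Lemma tau_opser_eq c t f g : tau f = tau g ->
  tau (opser size c (tact t) f) = tau (opser size c (tact t) g).
Proof.
move=> E; apply/eqP; rewrite -subr_eq0 -tauB.
have -> : (opser size c (tact t) f : ser R n) - (opser size c (tact t) g : ser R n) =
    opser size c (tact t) (-1 *: g + f).
  rewrite (opser_lin _ _ (tact_lin t) (-1) g f).
  by apply: funext => v; rewrite addfE oppfE; ring.
rewrite tau_opser //; first exact: tau_tact.
by rewrite tau_lin E scaleN1r addNr.
Qed.

Lemma tau_opser_inv c t f : good t -> tau (tact t f) = 0 ->
  tau (opser size c (tact t) f) = c 0%N *: tau f.
Proof.
move=> gt tf; have -> : opser size c (tact t) f =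
    c 0%N *: f + (opser size (fun k => c k.+1) (tact t) (tact t f) : ser R n).
  by apply: funext => v; rewrite (opser_shift _ _ _ (tact_lin t) (tact_raising gt)).
by rewrite tau_lin (tau_opser _ (@tau_tact t) tf) addr0.
Qed.

Definition emb f (r : R) : option (seq 'I_n) -> R := fun o => if o is Some w then f w else r.

Lemma ops_emb0 t f k : iter k (ops t) (emb f 0) = emb (iter k (tact t) f) 0.
Proof.
elim: k => // k IH; rewrite !iterS IH; apply: funext => -[w|] //=.
by rewrite mul0r addr0.
Qed.

Lemma opser_emb0 c t f : opser (@osz n) c (ops t) (emb f 0) = emb (opser size c (tact t) f) 0.
Proof.
apply: funext => -[w|]; rewrite /opser /=.
  by apply: eq_bigr => k _; rewrite ops_emb0.
by rewrite big1 // => k _; rewrite ops_emb0 mulr0.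
Qed.

Lemma opser_emb1 t : good t ->
  opser (@osz n) expc (ops t) (emb 0 1) = emb (tj t) 1.
Proof.
move=> gt; apply: funext => v.
rewrite (opser_shift _ _ _ (ops_lin t) (ops_raising gt)).
have -> : ops t (emb 0 1) = emb t.2 0.
  apply: funext => -[w|] //=; rewrite [der_act _ _](_ : _ = 0) ?zerofE ?add0r ?mul1r //.
  exact: der0.
rewrite opser_emb0; case: v => [w|] /=; first by rewrite zerofE mulr0 add0r.
by rewrite /expc invr1 mulr1 addr0.
Qed.

Lemma texp_opser t f w : opser (@osz n) expc (ops t) (emb f 0) (Some w) = texp t f w.
Proof. by rewrite opser_emb0. Qed.

Lemma emb_split f : emb f 1 = (fun o => 1 * emb f 0 o + emb 0 1 o).
Proof. by apply: funext => -[w|] /=; rewrite mul1r ?addr0 ?add0r. Qed.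

Lemma texp_comp t t' : good t -> good t' -> exists t'', [/\ good t'',
  forall f, texp t (texp t' f) = texp t'' f & tj t'' = tj t + texp t (tj t')].
Proof.
move=> gt gt'.
(* The theorem is used only for the two free generators; [rho] then sends x and y to the operators
   of [t] and [t']. *)
have [w [Lw Ew]] := bch char0 (is_lie_sgen R ix) (is_lie_sgen R iy).
pose ts (j : 'I_2) := if j == ix then t else t'.
have gts j : good (ts j) by rewrite /ts; case: eqP.
have [s [gs Es]] := rho_lie char0 gts Lw.
pose P j := ops (ts j).
have Pl j : lin (P j) by exact: ops_lin.
have Pr j : raising (@osz n) (P j) by exact: ops_raising.
have R0 (z : ser R 2) s' : z [::] = 0 -> (forall phi, rho (@osz n) P z phi = ops s' phi) ->
    forall phi, rho (@osz n) P (expo z) phi = opser (@osz n) expc (ops s') phi.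
  by move=> z0 E phi; rewrite (rho_expo Pl Pr _ z0) (_ : rho _ _ z = ops s') //; apply: funext.
have C phi : opser (@osz n) expc (ops s) phi =
    opser (@osz n) expc (ops t) (opser (@osz n) expc (ops t') phi).
  rewrite -(R0 w s (is_lie_nil Lw) Es) Ew rho_mul //.
  rewrite (R0 (sgen iy) t') => [||psi] //; last exact: (rho_gen Pl Pr iy).
  by rewrite (R0 (sgen ix) t) => [||psi] //; exact: (rho_gen Pl Pr ix).
exists s; split=> // [f|].
  by apply: funext => v; rewrite -texp_opser -[RHS]texp_opser C (opser_emb0 _ t').
(* The pair (0, 1) reads off the inhomogeneous part of the exponential, which is j. *)
apply: funext => v; have := congr1 (fun phi => phi (Some v)) (C (emb 0 1)).
rewrite !opser_emb1 // (emb_split (tj t')).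
rewrite (opser_lin _ _ (ops_lin t) 1 (emb (tj t') 0) (emb 0 1)) opser_emb1 // opser_emb0 /=.
by rewrite mul1r addrC.
Qed.

Lemma good_opp t : good t -> good (- t).
Proof. by move=> gt; rewrite -scaleN1r -[_ *: _]addr0; apply/good_lin/good0. Qed.

Lemma ops_opp t phi : ops (- t) phi = (fun o => - ops t phi o).
Proof.
have := ops_linr (-1) t 0 phi; rewrite addr0 scaleN1r => ->.
by apply: funext => o; rewrite ops0 addr0 mulN1r.
Qed.

(** Both claims are e^(-x) e^x = 1 in one letter, transported by sending x to the operator of [t]
    and evaluated at (f, 0) and (0, 1). *)
Lemma texp_inv t : good t ->
  (forall f, texp (- t) (texp t f) = f) /\ tj (- t) + texp (- t) (tj t) = 0.
Proof.
move=> gt; have gnt := good_opp gt.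
pose P (j : 'I_1) := ops t.
have Pl j : lin (P j) by exact: ops_lin.
have Pr j : raising (@osz n) (P j) by exact: ops_raising.
pose x : ser R 1 := sgen ord0.
have ex : eul x = x.
  by apply: funext => w; rewrite /eul /x /sgen; case: eqP => [->|]; rewrite ?mulr0 ?mul1r.
have R0 (z : ser R 1) s' : z [::] = 0 -> (forall phi, rho (@osz n) P z phi = ops s' phi) ->
    forall phi, rho (@osz n) P (expo z) phi = opser (@osz n) expc (ops s') phi.
  by move=> z0 E phi; rewrite (rho_expo Pl Pr _ z0) (_ : rho _ _ z = ops s') //; apply: funext.
have C phi : opser (@osz n) expc (ops (- t)) (opser (@osz n) expc (ops t) phi) = phi.
  rewrite -(R0 x t) // => [|psi]; last exact: (rho_gen Pl Pr).
  rewrite -(R0 (- x) (- t)) => [||psi]; rewrite ?oppfE ?oppr0 //.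
    by rewrite -rho_mul // expo_inv // rho1.
  by rewrite rho_opp // ops_opp (rho_gen Pl Pr).
split=> [f|].
  by apply: funext => v; rewrite -texp_opser -(opser_emb0 expc t) C.
apply: funext => v; have := congr1 (fun phi => phi (Some v)) (C (emb 0 1)).
rewrite opser_emb1 // (emb_split (tj t)).
rewrite (opser_lin _ _ (ops_lin _) 1 (emb (tj t) 0) (emb 0 1)) opser_emb1 // opser_emb0 /=.
by rewrite mul1r addrC.
Qed.

Lemma texp_linr t (c : R) f g : texp t (c *: f + g) = c *: texp t f + texp t g.
Proof. exact: (opser_lin _ _ (tact_lin t) c f g). Qed.
Lemma texpD t f g : texp t (f + g) = texp t f + texp t g.
Proof. by rewrite -[f in LHS]scale1r texp_linr scale1r. Qed.
Lemma texp0 t : texp t 0 = 0.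
Proof. exact: (lin0 (opser_lin _ _ (tact_lin t))). Qed.
Lemma texpZ t (c : R) f : texp t (c *: f) = c *: texp t f.
Proof. by rewrite -[c *: f]addr0 texp_linr texp0 addr0. Qed.
Lemma texpN t f : texp t (- f) = - texp t f.
Proof. by rewrite -scaleN1r texpZ scaleN1r. Qed.
Lemma texpB t f g : texp t (f - g) = texp t f - texp t g.
Proof. by rewrite texpD texpN. Qed.

Lemma leibniz t f g m : iter m (tact t) (f * g) = \sum_(k < m.+1)
  'C(m, k)%:R *: (iter (m - k) (tact t) f * iter k (tact t) g).
Proof.
elim: m f g => [|m IH] f g; first by rewrite big_ord1 /= scale1r.
rewrite (pascal_sum (fun k => iter (m.+1 - k) (tact t) f * iter k (tact t) g)).
have itD k (h1 h2 : ser R n) : iter k (tact t) (h1 + h2) = iter k (tact t) h1 + iter k (tact t) h2.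
  by elim: k => //= k ->; exact: derD.
rewrite iterSr tact_mul itD !IH; congr (_ + _); apply: eq_bigr => k _.
  by rewrite -iterSr subSn // -ltnS.
by rewrite subSS -iterSr.
Qed.

Lemma texp_mul t f g : good t -> texp t (f * g) = texp t f * texp t g.
Proof.
move=> gt; apply: funext => v; set N := size v.
have Tr h : slo N.+1 (texp t h) (\sum_(i < N.+1) expc i *: (iter i (tact t) h : ser R n)).
  move=> u hu; rewrite sumfE.
  exact: (@opser_trunc _ _ _ _ _ h N u (tact_lin t) (tact_raising gt) hu).
rewrite (slo_mul (Tr f) (Tr g)) // Tr // mulr_suml !sumfE.
transitivity (\sum_(i < N.+1) \sum_(j < N.+1)
   expc i * expc j * (iter i (tact t) f * iter j (tact t) g : ser R n) v).
  rewrite (sum_triangle (F := fun i j => expc i * expc j *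
     (iter i (tact t) f * iter j (tact t) g : ser R n) v)).
    apply: eq_bigr => m _; rewrite scalefE leibniz sumfE mulr_sumr.
    by apply: eq_bigr => k _; rewrite scalefE mulrA expc_bin // -ltnS.
  move=> i j hij.
  have H k h : slo k (iter k (tact t) h) (0 : ser R n).
    by move=> u hu; rewrite (iter_small (sz := size) _ (tact_lin t) (tact_raising gt)).
  suff -> : (iter i (tact t) f * iter j (tact t) g : ser R n) v = 0 by rewrite mulr0.
  rewrite -smulE /smul big1 // => l _; have hl := ltn_ord l.
  have [h|h] := ltnP l i.
    by rewrite (H i f) ?mul0r // size_takel // -ltnS.
  rewrite (H j g) ?mulr0 // size_drop ltn_subLR -1?ltnS //.
  by apply: leq_trans hij _; rewrite leq_add2r.
apply: eq_bigr => i _; rewrite mulr_sumr sumfE; apply: eq_bigr => j _.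
by rewrite -scalerAl -scalerAr scalerA scalefE.
Qed.

Lemma texp_nil t f : texp t f [::] = f [::].
Proof. by rewrite /texp /opser big_ord1 /= /expc invr1 mul1r. Qed.

Lemma texp1 t : texp t 1 = 1.
Proof.
have it k : iter k.+1 (tact t) 1 = 0.
  rewrite iterSr (_ : tact t 1 = 0); last by apply: der1 => i; apply: tder_nil.
  by elim: k => // k IH; rewrite iterS IH; exact: der0.
apply: funext => v; rewrite /texp /opser big_ord_recl big1 => [|k _].
  by rewrite /= /expc invr1 mul1r addr0.
by rewrite (it k) zerofE mulr0.
Qed.

Lemma texp_ps_eval t c z : good t -> z [::] = 0 ->
  texp t (ps_eval c z) = ps_eval c (texp t z).
Proof.
move=> gt z0; have powE m : texp t (z ^+ m) = texp t z ^+ m.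
  by elim: m => [|m IH]; rewrite ?expr0 ?texp1 // !exprS texp_mul // IH.
apply: (@eqlo_all _ _ size) => -[|N] // v hv.
have H : slo N.+1 (ps_eval c z) (\sum_(k < N.+1) c k *: z ^+ k).
  by move=> u hu; apply: ps_eval_trunc.
rewrite {1}/texp (opser_eqlo expc (tact_raising gt) H hv) -/(texp t _).
rewrite (@ps_eval_trunc _ _ c (texp t z) N v) ?texp_nil //.
rewrite (big_morph _ (texpD t) (texp0 t)) !sumfE; apply: eq_bigr => k _.
rewrite texpZ !scalefE powE //.
Qed.

(** A tangential derivation acts on series in x_i alone as the bracket with its component a_i. *)
Lemma tau_tact_gen t c i : good t -> tau (tact t (ps_eval c (sgen i))) = 0.
Proof.
move=> gt; have D0 j : tder t.1 j [::] = 0 by exact: tder_nil.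
have powE m : der_act (tder t.1) (sgen i ^+ m) = sbr (sgen i ^+ m) (t.1 i).
  elim: m => [|m IH]; first by rewrite expr0 der1 // sbrE mul1r mulr1 subrr.
  rewrite exprS der_mul // IH der_sgen // tderE !sbrE mulrBl mulrBr !mulrA.
  by apply: funext => u; rewrite !(addfE, oppfE); ring.
suff -> : tact t (ps_eval c (sgen i)) = sbr (ps_eval c (sgen i)) (t.1 i).
  exact: tau_sbr.
apply: (@eqlo_all _ _ size) => -[|N] // v hv.
have H : slo N.+1 (ps_eval c (sgen i)) (\sum_(k < N.+1) c k *: (sgen i : ser R n) ^+ k).
  by move=> u hu; apply: ps_eval_trunc.
rewrite {1}/tact (der_eqlo D0 H hv).
transitivity (sbr (\sum_(k < N.+1) c k *: (sgen i : ser R n) ^+ k) (t.1 i) v).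
  rewrite sbr_suml (big_morph _ (derD _) (der0 _)) !sumfE; apply: eq_bigr => k _.
  by rewrite derZ sbrZl !scalefE powE.
rewrite !sbrE !addfE !oppfE.
by rewrite (slo_mul H (fun _ _ => erefl) hv) (slo_mul (fun _ _ => erefl) H hv).
Qed.

End Exponential.

(** * Solutions of the Kashiwara-Vergne problem *)

Section KashiwaraVergne.
Variable R : fieldType.
Hypothesis char0 : [pchar R] =i pred0.
Implicit Types (a b f g : ser R 2) (t : tri R 2) (c : nat -> R).

Definition tri2 a b : tri R 2 := ([ffun i => if i == ix then a else b], divser a b).

Lemma tder_tri2 a b : tder (tri2 a b).1 = tder_gen a b.
Proof.
by apply: funext => i; rewrite /tder_gen /tder ffunE; case: (i2P i) => ->.
Qed.

Lemma dive_tri2 a b : dive (tri2 a b).1 = divser a b.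
Proof.
rewrite /dive (bigD1 ix) // (big_pred1 iy) ?ffunE // => i.
by case: (i2P i) => ->.
Qed.

Lemma good_tri2 a b : is_tder a b -> good (tri2 a b).
Proof.
case=> La Lb a0 b0; split=> [i|i|]; rewrite ?dive_tri2 // ffunE;
  by case: (i2P i) => ->.
Qed.

Lemma texp_tri2 a b : texp (tri2 a b) = sexp (tder_gen a b).
Proof. by apply: funext => f; rewrite /texp /tact tder_tri2. Qed.

Lemma tj_tri2 a b : tj (tri2 a b) = jser a b.
Proof. by rewrite /tj /tact tder_tri2. Qed.

Lemma is_tder_good t : good t -> is_tder (t.1 ix) (t.1 iy).
Proof. by case. Qed.

Lemma good_tder t : tder (tri2 (t.1 ix) (t.1 iy)).1 = tder t.1.
Proof.
by apply: funext => i; rewrite !tderE ffunE; case: (i2P i) => ->.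
Qed.

Lemma tact_good t : tact (tri2 (t.1 ix) (t.1 iy)) = tact t.
Proof. by rewrite /tact good_tder. Qed.

Lemma tau_jser_good t : good t -> tau (jser (t.1 ix) (t.1 iy)) = tau (tj t).
Proof.
case=> _ _ E; rewrite -tj_tri2 /tj tact_good; apply: tau_opser_eq => //.
rewrite E /= -dive_tri2; congr (tau (dive _)).
by apply: funext => i; rewrite ffunE; case: (i2P i) => ->.
Qed.

Lemma tact_sxy a b : tact (tri2 a b) (sx + sy) = sadd (sbr sx a) (sbr sy b).
Proof. by rewrite /tact derD !der_sgen ?tder_tri2 // => i; rewrite -?tder_tri2; exact: tder_nil. Qed.

Lemma sxy_nil : (sx + sy : ser R 2) [::] = 0.
Proof. by rewrite addfE addr0. Qed.
Lemma ch_nil : (ch : ser R 2) [::] = 0.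
Proof. by rewrite /ch /ps_eval big_ord1 mul0r. Qed.

Lemma tau_texp t f g : tau f = tau g -> tau (texp t f) = tau (texp t g).
Proof. exact: tau_opser_eq. Qed.

Lemma tau_texp_gen t c i : good t ->
  tau (texp t (ps_eval c (sgen i))) = tau (ps_eval c (sgen i)).
Proof.
move=> gt; rewrite /texp tau_opser_inv ?tau_tact_gen //.
by rewrite /expc invr1 scale1r.
Qed.

(* The classes of both deltas are Tr (c x) + Tr (c y) minus Tr (c z) with z = x + y
   or z = ch; a tangential automorphism fixes the first two. *)
Lemma tau_texp_delta t c z z' : good t -> z [::] = 0 -> texp t z = z' ->
  tau (texp t (ps_eval c sx - ps_eval c z + ps_eval c sy)) =
  tau (ps_eval c sx - ps_eval c z' + ps_eval c sy).
Proof.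
move=> gt z0 E; rewrite texpD texpB !(tauD, tauB) !tau_texp_gen //.
by rewrite texp_ps_eval // E.
Qed.

Lemma tdeltaE c : tdelta c = ps_eval c sx - ps_eval c ch + ps_eval c sy.
Proof. by []. Qed.

Lemma tdelta_lin (k : R) c c' :
  tdelta (fun m => k * c m + c' m) = k *: tdelta c + tdelta c'.
Proof.
have E z : ps_eval (fun m => k * c m + c' m) z = k *: ps_eval c z + ps_eval c' z.
  apply: funext => v; rewrite addfE scalefE /ps_eval mulr_sumr -big_split.
  by apply: eq_bigr => i _ /=; ring.
rewrite !tdeltaE !E; apply: funext => v.
by rewrite !(addfE, oppfE, scalefE); ring.
Qed.

Lemma tau_tact_delta1 a b c : is_sder a b ->
  tau (tact (tri2 a b) (delta1 c)) = 0.
Proof.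
move=> [td s0]; have gt := good_tri2 td; rewrite /delta1.
have e1 (h1 h2 : ser R 2) : tact (tri2 a b) (h1 + h2) = tact (tri2 a b) h1 + tact (tri2 a b) h2.
  exact: derD.
have e2 (h1 : ser R 2) : tact (tri2 a b) (- h1) = - tact (tri2 a b) h1 by exact: derN.
rewrite !e1 e2 !tauD tauN !tau_tact_gen // add0r addr0.
suff -> : tact (tri2 a b) (ps_eval c (sx + sy)) = 0 by rewrite tau0 oppr0.
have D0 j : tder (tri2 a b).1 j [::] = 0 by exact: tder_nil.
have powE m : tact (tri2 a b) ((sx + sy) ^+ m) = 0.
  elim: m => [|m IH]; first by rewrite expr0 [tact _ _]der1.
  rewrite exprS tact_mul IH mulr0 addr0 tact_sxy.
  by rewrite (funext s0) mul0r.
apply: (@eqlo_all _ _ size) => -[|N] // v hv.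
have H : slo N.+1 (ps_eval c (sx + sy)) (\sum_(k < N.+1) c k *: (sx + sy : ser R 2) ^+ k).
  by move=> u hu; apply: ps_eval_trunc => //; exact: sxy_nil.
rewrite {1}/tact (der_eqlo D0 H hv) (big_morph _ (derD _) (der0 _)) big1 // => k _.
by rewrite derZ -/(tact _ _) powE scaler0.
Qed.

Lemma tau_local (f : ser R 2) N :
  tau (trunc size N f) = trunc size N (tau f) :> ser R 2.
Proof.
apply: funext => -[|i w]; first by rewrite /tau /trunc.
rewrite /tau /trunc; set u := i :: w.
case: ifP => hu; last by rewrite big1 // => j _; rewrite size_rot hu.
by apply: eq_bigr => j _; rewrite size_rot hu.
Qed.

Lemma expcS_neq0 : (expc 1 : R) != 0.
Proof. by rewrite /expc invr1 oner_eq0. Qed.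

(** Injectivity of (e^u - 1)/u on tr: [opser_inj] with the series of zero trace as invariant
    subspace. *)
Lemma tau_opser_ker t f : good t ->
  tau (opser size (fun k => expc k.+1) (tact t) f) = 0 -> tau f = 0.
Proof.
move=> gt; pose K (h : seq 'I_2 -> R) := tau h = 0.
apply: (opser_inj (K := K) (tact_lin t) (tact_raising gt) expcS_neq0).
- move=> d phi psi hphi hpsi.
  by have := tau_lin d (phi : ser R 2) psi; rewrite hphi hpsi scaler0 addr0.
- exact: tau0.
- move=> phi N hphi; rewrite /K tau_local hphi.
  by apply: funext => v; rewrite /trunc if_same.
- move=> phi h; apply: funext => v.
  have := congr1 (fun h : ser R 2 => h v) (h (size v).+1).
  by rewrite tau_local /trunc ltnSn.
- by move=> phi hphi; apply: tau_opser => [g|]; exact: tau_tact.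
Qed.

(** e^u f - f is (e^u - 1)/u applied to u.f, and that operator is injective on series. *)
Lemma texp_fix t f : good t -> texp t f = f -> tact t f = 0.
Proof.
move=> gt E; pose K (h : seq 'I_2 -> R) := h = (fun=> 0).
have E1 : opser size (fun k => expc k.+1) (tact t) (tact t f) = (fun=> 0).
  apply: funext => v; have := congr1 (fun h : ser R 2 => h v) E.
  rewrite /texp (opser_shift _ _ _ (tact_lin t) (tact_raising gt)).
  rewrite [expc 0](_ : _ = 1) ?mul1r => [H|]; last by rewrite /expc invr1.
  by apply: (addrI (f v)); rewrite H addr0.
have op0 c : opser size c (tact t) (fun=> 0) = (fun=> 0).
  exact: (lin0 (opser_lin _ _ (tact_lin t))).
apply: (opser_inj (K := K) (tact_lin t) (tact_raising gt) expcS_neq0) (E1).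
- by move=> d phi psi -> ->; apply: funext => v; rewrite mulr0 addr0.
- by [].
- by move=> phi N ->; apply: funext => v; rewrite /trunc if_same.
- move=> phi h; apply: funext => v.
  by have := congr1 (fun h => h v) (h (size v).+1); rewrite /trunc ltnSn.
- by move=> phi ->; rewrite /K (lin0 (tact_lin t)) op0.
Qed.

Lemma texp_invr t f : good t -> texp t (texp (- t) f) = f.
Proof.
move=> gt; have [h _] := texp_inv char0 (good_opp gt).
by rewrite -{1}[t]opprK h.
Qed.

Lemma divser_nil a b : divser a b [::] = 0.
Proof. by rewrite /divser /sadd !smul_nil !mul0r addr0. Qed.

Lemma tau_jser_kv a b : is_kv a b -> exists c, [/\ c 0%N = 0,
  tau (divser a b) = tau (delta1 c) & tau (jser a b) = tau (delta1 c)].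
Proof.
move=> [sd /(trzP char0) cz]; have [td _] := sd; have gt := good_tri2 td.
have [c [c0 E]] := cocycle_coboundary char0 (divser_nil a b) cz.
exists c; split=> //; rewrite -tj_tri2 /tj (@tau_opser_eq _ _ char0 _ _ _ (delta1 c) E).
rewrite tau_opser_inv //; last exact: tau_tact_delta1.
by rewrite /expc invr1 scale1r.
Qed.

Lemma texp_sder a b : is_sder a b -> texp (tri2 a b) (sx + sy) = sx + sy.
Proof.
move=> [td s0]; have gt := good_tri2 td; apply: funext => v.
have Z : tact (tri2 a b) (sx + sy) = (fun=> 0) by rewrite tact_sxy; apply: funext.
rewrite /texp (opser_shift _ _ _ (tact_lin _) (tact_raising gt)) Z.
by rewrite (lin0 (opser_lin _ _ (tact_lin _))) /expc invr1 mul1r addr0.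
Qed.

Lemma is_SolP (F : ser R 2 -> ser R 2) : is_Sol F <-> exists t, [/\ good t, F = texp t,
  texp t (sx + sy) = ch & exists c, c 0%N = 0 /\ tau (tj t) = tau (tdelta c)].
Proof.
split=> [[a [b [td hF hs [c [c0 /(tr_eqP char0) E]]]]]|[t [gt -> hs [c [c0 E]]]]].
  have FE : F = texp (tri2 a b).
    by rewrite texp_tri2; apply: funext => f; apply: funext; exact: hF.
  exists (tri2 a b); split=> //; first exact: good_tri2.
    by rewrite -FE; exact: funext.
  by exists c; rewrite tj_tri2.
exists (t.1 ix), (t.1 iy); split.
- exact: is_tder_good.
- by move=> f v; rewrite -texp_tri2 /texp tact_good.
- by move=> v; rewrite saddE hs.
by exists c; split=> //; apply/(tr_eqP char0); rewrite tau_jser_good.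
Qed.

Lemma Sol_mul (F g : ser R 2 -> ser R 2) : is_Sol F -> is_KVg g -> is_Sol (fun f => F (g f)).
Proof.
move=> /is_SolP [t [gt -> hs [c [c0 E]]]] [a [b [kv hg]]].
have sd := kv.1; have gt' := good_tri2 sd.1.
have gE : g = texp (tri2 a b).
  by rewrite texp_tri2; apply: funext => f; apply: funext; exact: hg.
have [s [gs Es Ej]] := texp_comp char0 gt gt'.
have [c' [c0' _ E']] := tau_jser_kv kv.
apply/is_SolP; exists s; split=> //.
- by rewrite gE; apply: funext => f; exact: Es.
- by rewrite -Es texp_sder.
(* From j(Fg) = j(F) + F.j(g), where F carries [delta1 c'] to [tdelta c']. *)
exists (fun m => 1 * c m + c' m); split; first by rewrite c0 c0' mulr0 addr0.
rewrite Ej tauD E tdelta_lin scale1r [RHS]tauD; congr (_ + _).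
rewrite tj_tri2 (@tau_texp _ _ (delta1 c') E') /delta1.
exact: (tau_texp_delta _ gt sxy_nil hs).
Qed.

Lemma Sol_free (F g : ser R 2 -> ser R 2) : is_Sol F -> is_KVg g ->
  (forall f, F (g f) =1 F f) -> forall f, g f =1 f.
Proof.
move=> /is_SolP [t [gt -> _ _]] _ h f v; have [inv _] := texp_inv char0 gt.
by rewrite -[g f]inv (funext (h f)) inv.
Qed.

Lemma Sol_trans (F1 F2 : ser R 2 -> ser R 2) : is_Sol F1 -> is_Sol F2 ->
  exists g : ser R 2 -> ser R 2, is_KVg g /\ forall f, F2 f =1 F1 (g f).
Proof.
move=> /is_SolP [t1 [g1 -> s1 [c1 [c10 E1]]]] /is_SolP [t2 [g2 -> s2 [c2 [c20 E2]]]].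
have gn := good_opp g1; have [inv Ji] := texp_inv char0 g1.
have [s [gs Es Ej]] := texp_comp char0 gn g2.
exists (texp s); split; last by move=> f v; rewrite -Es texp_invr.
have chE : texp (- t1) ch = sx + sy by rewrite -s1 inv.
have sxyE : texp s (sx + sy) = sx + sy by rewrite -Es s2.
pose c m := -1 * c1 m + c2 m.
have c0 : c 0%N = 0 by rewrite /c c10 c20 mulr0 addr0.
have tjs : tau (tj s) = tau (delta1 c).
  (* The cocycle rule with j(F1^-1) = - F1^-1.j(F1). *)
  have -> : tj s = texp (- t1) (tj t2 - tj t1).
    by rewrite Ej texpB addrC; congr (_ + _); apply/eqP; rewrite -addr_eq0 Ji.
  rewrite (@tau_texp _ _ (tdelta c)); first exact: (tau_texp_delta _ gn ch_nil chE).
  by rewrite tauB E1 E2 tdelta_lin [RHS]tauD tauZ scaleN1r addrC.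
have sd : is_sder (s.1 ix) (s.1 iy).
  split; first exact: is_tder_good.
  have := texp_fix gs sxyE; rewrite -tact_good tact_sxy => Z v; by rewrite Z.
exists (s.1 ix), (s.1 iy); split; last by move=> f v; rewrite -texp_tri2 /texp tact_good.
split=> //; apply/(trzP char0).
apply: (coboundary_cocycle c0); apply/eqP; rewrite -subr_eq0 -tauB; apply/eqP.
have gs' := good_tri2 sd.1; apply: (tau_opser_ker gs').
set P := tact _.
(* (e^u - 1)/u takes the divergence to j, and fixes [delta1 c] in tr because u kills it there; both
   images agree by [tjs]. *)
have -> : opser size (fun k => expc k.+1) P (divser (s.1 ix) (s.1 iy) - delta1 c) =
    -1 *: (opser size (fun k => expc k.+1) P (delta1 c) : ser R 2)
    + tj (tri2 (s.1 ix) (s.1 iy)).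
  have := opser_lin size (fun k => expc k.+1) (tact_lin (tri2 (s.1 ix) (s.1 iy)))
    (-1) (delta1 c) (divser (s.1 ix) (s.1 iy)).
  move=> H; apply: etrans H; congr (opser _ _ _ _); apply: funext => v.
  by rewrite addfE oppfE; ring.
rewrite tau_lin tau_opser_inv // ?tau_tact_delta1 // tj_tri2 tau_jser_good // tjs.
by rewrite /expc invr1 scale1r scaleN1r addNr.
Qed.

End KashiwaraVergne.

Theorem theorem5p9 (R : fieldType) (hR : [pchar R] =i pred0) :
  (exists F : ser R 2 -> ser R 2, is_Sol F) ->
  [/\ (* right multiplication by KV-hat_2 preserves Sol *)
      (forall F g : ser R 2 -> ser R 2, is_Sol F -> is_KVg g ->
         is_Sol (fun f => F (g f))),
      (* freeness *)
      (forall F g : ser R 2 -> ser R 2, is_Sol F -> is_KVg g ->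
         (forall f, F (g f) =1 F f) -> forall f, g f =1 f) &
      (* transitivity *)
      (forall F1 F2 : ser R 2 -> ser R 2, is_Sol F1 -> is_Sol F2 ->
         exists g : ser R 2 -> ser R 2, is_KVg g /\ forall f, F2 f =1 F1 (g f))].
Proof.
move=> _; split=> F g.
- exact: Sol_mul.
- exact: Sol_free.
- exact: Sol_trans.
Qed.
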